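(* Let $A$ be an algebra in $\mathcal{V}$ such that $K(A)$ is closed under the commutator operation. If $A$ satisfies the condition $(\star)$, then the function $w:VCon(A)\rightarrow VId(L(A))$, defined by $w(\theta)=\theta^{\ast}$ for all $\theta\in VCon(A)$, is a frame isomorphism.
   Context: $\mathcal{V}$ is a fixed congruence-modular variety of algebras (of a finite signature) that is semidegenerate: no nontrivial algebra in $\mathcal{V}$ has one-element subalgebras (equivalently, $\nabla_A$ is compact in $Con(A)$ for every $A\in\mathcal{V}$). For $A\in\mathcal{V}$, $Con(A)$ is the complete lattice of congruences of $A$, with least element $\Delta_A$ and greatest element $\nabla_A$; $K(A)$ is the set of compact (= finitely generated) congruences. Commutator: $[\cdot,\cdot]=[\cdot,\cdot]_A$ is the (modular) commutator, i.e. the greatest operation on the congruence lattices of members of $\mathcal{V}$ such that for every surjective morphism $f:A\to B$ in $\mathcal{V}$ and all $\alpha,\beta\in Con(A)$: $[\alpha,\beta]_A\subseteq\alpha\cap\beta$ and $[\alpha,\beta]_A\vee Ker(f)=f^{-1}([f(\alpha\vee Ker(f)),f(\beta\vee Ker(f))]_B)$. It is commutative, monotone and distributes over arbitrary joins. Put $\alpha^{\perp}=\bigvee\{\gamma\in Con(A)\mid[\alpha,\gamma]=\Delta_A\}$. Iterates: $[\alpha,\alpha]^0=\alpha$, $[\alpha,\beta]^1=[\alpha,\beta]$, $[\alpha,\beta]^{n+1}=[[\alpha,\beta]^n,[\alpha,\beta]^n]$. Condition $(\star)$: for all $\alpha,\beta\in K(A)$ and every integer $n\geq 1$ there is an integer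 $m\geq 0$ with $[[\alpha,\alpha]^m,[\beta,\beta]^m]\subseteq[\alpha,\beta]^n$. Prime congruences and radical: $\phi\in Con(A)\setminus\{\nabla_A\}$ is prime if $[\alpha,\beta]\subseteq\phi$ implies $\alpha\subseteq\phi$ or $\beta\subseteq\phi$ (for $\alpha,\beta\in Con(A)$); $Spec(A)$ is the set of prime congruences; $\rho(\theta)=\bigcap\{\phi\in Spec(A)\mid\theta\subseteq\phi\}$. Reticulation: when $K(A)$ is closed under the commutator, $L(A)=K(A)/{\equiv}$ where $\alpha\equiv\beta$ iff $\rho(\alpha)=\rho(\beta)$; $\lambda_A:K(A)\to L(A)$ is the quotient map; $L(A)$ is a bounded distributive lattice with $\lambda_A(\alpha)\vee\lambda_A(\beta)=\lambda_A(\alpha\vee\beta)$, $\lambda_A(\alpha)\wedge\lambda_A(\beta)=\lambda_A([\alpha,\beta])$, $0=\lambda_A(\Delta_A)$, $1=\lambda_A(\nabla_A)$. For $\theta\in Con(A)$, $\theta^{\ast}=\{\lambda_A(\alpha)\mid\alpha\in K(A),\alpha\subseteq\theta\}$, an ideal of $L(A)$. Pure congruences: $\theta\in Con(A)$ is pure if for every $\alpha\in K(A)$ with $\alpha\subseteq\theta$ one has $\theta\vee\alpha^{\perp}=\nabla_A$; $VCon(A)$ is the set of pure congruences, a frame under the joins of $Con(A)$ and finite intersections. $\sigma$-ideals: for a bounded distributive lattice $L$ and $x\in L$, $Ann(x)=\{y\in L\mid x\wedge y=0\}$; an ideal $I$ of $L$ is a $\sigma$-ideal if $I\vee Ann(x)=L$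 (join of ideals) for all $x\in I$; $VId(L)$ is the set of $\sigma$-ideals of $L$, a frame under joins of ideals and finite intersections. If $\theta$ is pure then $\theta^{\ast}$ is a $\sigma$-ideal of $L(A)$, so $w$ is well defined. *)

(* Defs.v *)
From HB Require Import structures.
From mathcomp Require Import all_boot all_order.
From mathcomp Require Import boolp classical_sets functions cardinality.

Set Implicit Arguments.
Unset Strict Implicit.
Unset Printing Implicit Defensive.

Import Order.TTheory.
Local Open Scope classical_set_scope.

Record signature := Signature { sym : finType; arity : sym -> nat }.

Record algebra (s : signature) := Algebra {
  carrier :> Type;
  alg_inh : inhabited carrier;
  opn : forall o : sym s, ('I_(arity o) -> carrier) -> carrier }.

Arguments opn {s} _ _ _.

Section Algebras.
Variable s : signature.
Implicit Types A B : algebra s.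

Definition is_hom A B (f : A -> B) : Prop :=
  forall (o : sym s) (x : 'I_(arity o) -> A), f (opn A o x) = opn B o (f \o x).

Record epi A B := Epi {
  epi_fun :> A -> B;
  epi_hom : is_hom epi_fun;
  epi_surj : forall y, exists x, epi_fun x = y }.

Definition subuniverse A (B : set A) : Prop :=
  forall (o : sym s) (x : 'I_(arity o) -> A), (forall i, B (x i)) -> B (opn A o x).

Lemma sub_inh A (B : set A) : B !=set0 -> inhabited {x : A | B x}.
Proof. by case=> x Bx; split; exists x. Qed.

Definition subalgebra A (B : set A) (B0 : B !=set0) (Bop : subuniverse B) :
    algebra s :=
  @Algebra s {x : A | B x} (sub_inh B0)
    (fun o x => exist B (opn A o (fun i => sval (x i)))
                        (Bop o _ (fun i => svalP (x i)))).

Lemma prod_inh (I : Type) (A : I -> algebra s) : inhabited (forall i, A i).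
Proof.
have P i : exists x : A i, True by case: (alg_inh (A i)) => x; exists x.
by split=> i; exact: (sval (cid (P i))).
Qed.

Definition product (I : Type) (A : I -> algebra s) : algebra s :=
  @Algebra s (forall i, A i) (prod_inh A)
    (fun o x i => opn (A i) o (fun k => x k i)).

Record variety := Variety {
  in_variety :> algebra s -> Prop;
  variety_sub : forall A (B : set A) (B0 : B !=set0) (Bop : subuniverse B),
    in_variety A -> in_variety (subalgebra B0 Bop);
  variety_img : forall A B, epi A B -> in_variety A -> in_variety B;
  variety_prod : forall (I : Type) (A : I -> algebra s),
    (forall i, in_variety (A i)) -> in_variety (product A) }.

Definition trivial A : Prop := forall x y : A, x = y.

Definition semidegenerate (V : variety) : Prop :=
  forall A, V A -> ~ trivial A -> ~ exists a : A, subuniverse [set a].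

End Algebras.

Record con (s : signature) (A : algebra s) := Con {
  con_rel :> set (A * A);
  con_refl : forall x, con_rel (x, x);
  con_sym : forall x y, con_rel (x, y) -> con_rel (y, x);
  con_trans : forall x y z, con_rel (x, y) -> con_rel (y, z) -> con_rel (x, z);
  con_comp : forall (o : sym s) (x y : 'I_(arity o) -> A),
    (forall i, con_rel (x i, y i)) -> con_rel (opn A o x, opn A o y) }.

Section Congruences.
Variables (s : signature) (A : algebra s).
Implicit Types (a b c : con A) (S : set (con A)) (R : set (A * A)).

Lemma con_eq a b : a `<=` b -> b `<=` a -> a = b.
Proof.
case: a b => [a a1 a2 a3 a4] [b b1 b2 b3 b4] /= ab ba.
have E : a = b by rewrite eqEsubset.
by case: b / E {ab ba} b1 b2 b3 b4 => *; congr Con; exact: Prop_irrelevance.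
Qed.

Definition Delta : con A.
Proof.
exists [set p | p.1 = p.2] => //= [x y z -> //|o x y xy].
by congr (opn A o _); exact/funext.
Defined.

Definition Nabla : con A.
Proof. by exists setT. Defined.

Definition con_meet a b : con A.
Proof.
exists (a `&` b).
- by move=> x; split; exact: con_refl.
- by move=> x y [p q]; split; exact: con_sym.
- by move=> x y z [p q] [p' q']; split; apply: con_trans; eassumption.
- by move=> o x y xy; split; apply: con_comp => i; case: (xy i).
Defined.

Definition con_inf S : con A.
Proof.
exists (\bigcap_(a in S) (a : set (A * A))).
- by move=> x a _; exact: con_refl.
- by move=> x y p a Sa; apply/con_sym/p.
- by move=> x y z p q a Sa; exact: con_trans (p a Sa) (q a Sa).
- by move=> o x y xy a Sa; apply: con_comp => i; exact: xy.
Defined.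

Definition cg R : con A := con_inf [set a | R `<=` a].

Definition con_join a b : con A := cg (a `|` b).

Definition con_sup S : con A := cg (\bigcup_(a in S) (a : set (A * A))).

Definition compact_con a : Prop :=
  forall S, a `<=` con_sup S ->
  exists F : set (con A), [/\ finite_set F, F `<=` S & a `<=` con_sup F].

Lemma sub_cg R : R `<=` cg R.
Proof. by move=> p Rp a; exact. Qed.

Lemma cg_sub R a : R `<=` a -> cg R `<=` a.
Proof. by move=> Ra p; exact. Qed.

Lemma con_joinP a b c : con_join a b `<=` c <-> a `<=` c /\ b `<=` c.
Proof.
split=> [abc|[ac bc]]; last by apply: (@cg_sub _ c); rewrite subUset.
by split=> p q; apply/abc/sub_cg; [left|right].
Qed.

Lemma con_supP S c : con_sup S `<=` c <-> (forall a, S a -> a `<=` c).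
Proof.
split=> [Sc a Sa p ap|Sc]; first by apply/Sc/sub_cg; exists a.
by apply: (@cg_sub _ c) => p [a Sa ap]; exact: Sc ap.
Qed.

Lemma con_joinl a b : a `<=` con_join a b.
Proof. by case: (con_joinP a b (con_join a b)) => /(_ (fun _ => id))[]. Qed.

Lemma con_joinr a b : b `<=` con_join a b.
Proof. by case: (con_joinP a b (con_join a b)) => /(_ (fun _ => id))[]. Qed.

Lemma con_sup_ub S a : S a -> a `<=` con_sup S.
Proof. by move=> Sa; have /con_supP := @subset_refl _ (con_sup S); exact. Qed.

Lemma con_sup_mono S S' : S `<=` S' -> con_sup S `<=` con_sup S'.
Proof. by move=> SS'; apply/con_supP => a Sa; apply/con_sup_ub/SS'. Qed.

Lemma Delta_sub a : Delta `<=` a.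
Proof. by move=> [x y] /= ->; exact: con_refl. Qed.

Lemma compact_cg R : finite_set R -> compact_con (cg R).
Proof.
move=> finR S RS.
pose U := [set p | exists F : set (con A),
  [/\ finite_set F, F `<=` S & con_rel (con_sup F) p]].
have dir n (p : 'I_n -> A * A) : (forall i, U (p i)) ->
    exists F : set (con A),
    [/\ finite_set F, F `<=` S & forall i, con_rel (con_sup F) (p i)].
  move=> /(@choice _ _ _)[F FP]; exists (\bigcup_(i in setT) F i); split.
  - by apply: bigcup_finite => [|i _]; [exact: finite_finset|case: (FP i)].
  - by move=> a [i _ Fa]; case: (FP i) => _ + _; exact.
  - move=> i; have [_ _] := FP i; apply: con_sup_mono => a Fa.
    by exists i.
have U1 x : U (x, x).
  by exists set0; split; [exact: finite_set0|exact: sub0set|exact: con_refl].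
have U2 x y : U (x, y) -> U (y, x).
  by move=> [F [? ? p]]; exists F; split=> //; exact: con_sym.
have U3 x y z : U (x, y) -> U (y, z) -> U (x, z).
  move=> [F [F1 F2 p]] [G [G1 G2 q]]; exists (F `|` G); split.
  - by rewrite finite_setU.
  - by rewrite subUset.
  - apply: (@con_trans _ _ _ x y).
      by apply: (con_sup_mono _ p) => a; left.
    by apply: (con_sup_mono _ q) => a; right.
have U4 (o : sym s) (x y : 'I_(arity o) -> A) :
    (forall i, U (x i, y i)) -> U (opn A o x, opn A o y).
  move=> /dir[F [F1 F2 p]]; exists F; split=> //.
  by apply: con_comp => i; exact: p.
have SU : con_sup S `<=` Con U1 U2 U3 U4.
  apply/con_supP => a Sa p ap; exists [set a]; split.
  - exact: finite_set1.
  - by move=> _ ->.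
  - by apply: (con_sup_ub _ ap).
have RU p : exists F : set (con A), R p ->
    [/\ finite_set F, F `<=` S & con_rel (con_sup F) p].
  have [Rp|nRp] := pselect (R p); last by exists set0.
  by have [F FP] := SU _ (RS _ (sub_cg Rp)); exists F.
have [F FP] := choice RU.
exists (\bigcup_(p in R) F p); split.
- by apply: bigcup_finite => // p /FP[].
- by move=> a [p /FP[_ + _]]; exact.
- apply: cg_sub => p Rp; have [_ _] := FP p Rp.
  by apply: con_sup_mono => a Fa; exists p.
Qed.

Lemma compact_Delta : compact_con Delta.
Proof.
move=> S _; exists set0; split; [exact: finite_set0|exact: sub0set|].
exact: Delta_sub.
Qed.

Lemma compact_join a b :
  compact_con a -> compact_con b -> compact_con (con_join a b).
Proof.
move=> ca cb S /con_joinP[/ca[F [F1 F2 F3]] /cb[G [G1 G2 G3]]].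
exists (F `|` G); split.
- by rewrite finite_setU.
- by rewrite subUset.
- apply/con_joinP; split.
    by apply: (subset_trans F3); apply: con_sup_mono => c; left.
  by apply: (subset_trans G3); apply: con_sup_mono => c; right.
Qed.

End Congruences.

Arguments Delta {s} A.
Arguments Nabla {s} A.

Section Morphisms.
Variables (s : signature) (A B : algebra s) (f : epi A B).

Definition preim (b : con B) : con A.
Proof.
exists [set p | con_rel b (f p.1, f p.2)] => /=.
- by move=> x; exact: con_refl.
- by move=> x y; exact: con_sym.
- by move=> x y z; exact: con_trans.
- by move=> o x y xy; rewrite !(epi_hom f); exact: con_comp.
Defined.

Definition ker : con A := preim (Delta B).

Lemma ker_sub_preim b : ker `<=` preim b.
Proof.
move=> [x y]; rewrite /ker /preim /= => ->; exact: con_refl.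
Qed.

(** [push a] is the direct image of [a \/ Ker f] *)
Definition push (a : con A) : con B.
Proof.
exists [set (f p.1, f p.2) | p in con_join a ker].
- by move=> y; have [x <-] := epi_surj f y; exists (x, x) => //; exact: con_refl.
- by move=> _ _ [[x y] p [<- <-]]; exists (y, x) => //; exact: con_sym.
- move=> u v w [[x y] p [<- <-]] [[y' z] q [e <-]].
  exists (x, z) => //; apply: (con_trans p); apply: (con_trans _ q).
  exact/con_joinr/esym.
- move=> o u v uv.
  have /choice[p pP] i : exists p,
      con_rel (con_join a ker) p /\ (f p.1, f p.2) = (u i, v i).
    by have [p] := uv i; exists p.
  exists (opn A o (fun i => (p i).1), opn A o (fun i => (p i).2)).
    by apply: con_comp => i; case: (pP i) => + _; case: (p i).
  have -> : u = f \o (fun i => (p i).1).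
    by apply/funext => i /=; case: (pP i) => _ [].
  have -> : v = f \o (fun i => (p i).2).
    by apply/funext => i /=; case: (pP i) => _ [].
  by rewrite -!(epi_hom f).
Defined.

Lemma preim_push a : preim (push a) = con_join a ker.
Proof.
apply: con_eq => [[x y] [[x' y'] p [ex ey]]|[x y] p]; last by exists (x, y).
apply: (@con_trans _ _ _ x x'); first exact/con_joinr/esym.
by apply: (con_trans p); apply/con_joinr.
Qed.

End Morphisms.

Section Quotient.
Variables (s : signature) (A : algebra s) (t : con A).

Definition cls (x : A) : set A := [set y | con_rel t (x, y)].

Definition quot_car : Type := {X : set A | exists x, X = cls x}.

Lemma quot_eq (X Y : quot_car) : sval X = sval Y -> X = Y.
Proof.
case: X Y => [X hX] [Y hY] /= e; case: Y / e hY => hY.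
by congr exist; exact: Prop_irrelevance.
Qed.

Definition quot_proj (x : A) : quot_car :=
  exist _ (cls x) (ex_intro _ x erefl).

Definition quot_repr (X : quot_car) : A := sval (cid (svalP X)).

Lemma quot_projP x y : quot_proj x = quot_proj y <-> con_rel t (x, y).
Proof.
split=> [[e]|txy].
  by have : cls y y by [exact: con_refl]; rewrite -e.
apply: quot_eq => /=; rewrite eqEsubset; split=> z; rewrite /cls /=.
  by apply: con_trans; exact: con_sym.
exact: con_trans.
Qed.

Lemma quot_reprK X : quot_proj (quot_repr X) = X.
Proof.
by apply: quot_eq => /=; rewrite /quot_repr; case: (cid _) => x /= ->.
Qed.

Lemma quot_inh : inhabited quot_car.
Proof. by case: (alg_inh A) => x; split; exact: (quot_proj x). Qed.

Definition quotient : algebra s :=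
  @Algebra s quot_car quot_inh
    (fun o X => quot_proj (opn A o (fun i => quot_repr (X i)))).

Lemma quot_proj_hom : @is_hom s A quotient quot_proj.
Proof.
move=> o x; apply/quot_projP/con_comp => i; apply/quot_projP.
by rewrite quot_reprK.
Qed.

Lemma quot_proj_surj (X : quotient) : exists x : A, quot_proj x = X.
Proof. by exists (quot_repr X); exact: quot_reprK. Qed.

Definition quot_epi : epi A quotient := Epi quot_proj_hom quot_proj_surj.

End Quotient.

(** One direction of Kollar's theorem: over a finite signature, forcing [a] to be idempotent takes finitely many pairs. *)
Lemma compact_Nabla (s : signature) (V : variety s) (A : algebra s) :
  semidegenerate V -> V A -> compact_con (Nabla A).
Proof.
move=> sV VA; case: (alg_inh A) => a.
pose g (o : sym s) : A * A := (opn A o (fun=> a), a).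
suff <- : cg (range g) = Nabla A.
  by apply/compact_cg/finite_image; exact: finite_finset.
apply: con_eq => // -[x y] _; apply/quot_projP.
set t := cg _; have VQ : V (quotient t) := variety_img (quot_epi t) VA.
apply: contrapT => nxy; apply: (sV _ VQ) => [/(_ (quot_proj t x) _)/nxy //|].
exists (quot_proj t a) => o X Xa.
have -> : X = quot_proj t \o (fun=> a) by apply/funext => i; exact: Xa.
apply: (etrans (esym (quot_proj_hom t (fun=> a)))); apply/quot_projP.
by apply: sub_cg; exists o.
Qed.

Definition congruence_modular (s : signature) (V : variety s) : Prop :=
  forall A, V A -> forall a b c : con A, a `<=` c ->
    con_meet (con_join a b) c = con_join a (con_meet b c).

Section Commutator.
Variables (s : signature) (V : variety s).

Definition con_op : Type := forall A : algebra s, con A -> con A -> con A.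

Definition commutator_axioms (c : con_op) : Prop :=
  forall A, V A -> forall a b : con A,
    c A a b `<=` a `&` b /\
    forall B, V B -> forall f : epi A B,
      con_join (c A a b) (ker f) = preim f (c B (push f a) (push f b)).

(** The operations satisfying the axioms are closed under pointwise joins, so
    the greatest one is the join of all of them; see [comm_greatest]. *)
Definition comm (A : algebra s) (a b : con A) : con A :=
  con_sup [set t | exists2 c, commutator_axioms c & c A a b = t].

Lemma comm_axioms : commutator_axioms comm.
Proof.
move=> A VA a b; split.
  rewrite subsetI; split; apply/con_supP => _ [c cP <-];
  by have [le _] := cP A VA a b; move=> p /le[].
move=> B VB f; apply: con_eq.
  apply/con_joinP; split; last exact: ker_sub_preim.
  apply/con_supP => _ [c cP <-] p cp.
  have [_ /(_ B VB f) cE] := cP A VA a b.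
  have : con_rel (con_join (c A a b) (ker f)) p by apply/con_joinl.
  rewrite cE; apply: (con_sup_ub (a := c B (push f a) (push f b))).
  by exists c.
suff le : comm (push f a) (push f b) `<=` push f (comm a b).
  by rewrite -preim_push => p /le.
apply/con_supP => _ [c cP <-] [u v].
have [x <-] := epi_surj f u; have [y <-] := epi_surj f v => cxy.
have [_ /(_ B VB f) cE] := cP A VA a b.
have : con_rel (preim f (c B (push f a) (push f b))) (x, y) by [].
rewrite -cE => xy; exists (x, y) => //; move: xy.
apply: (iffRL (con_joinP _ _ _)); split; last exact: con_joinr.
by apply: subset_trans (@con_joinl _ _ _ _); apply: con_sup_ub; exists c.
Qed.

Lemma comm_greatest (c : con_op) : commutator_axioms c ->
  forall A, V A -> forall a b : con A, c A a b `<=` comm a b.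
Proof. by move=> cP A VA a b; apply: con_sup_ub; exists c. Qed.

Section OneAlgebra.
Variable A : algebra s.
Implicit Types (a b t phi : con A).

Definition perp a : con A := con_sup [set c | comm a c = Delta A].

(** [comm_iter a b n] is [[a,b]^n]; the index 0 is only meant for [a = b] *)
Fixpoint comm_iter a b (n : nat) : con A :=
  match n with
  | 0 => a
  | 1 => comm a b
  | n'.+1 => comm (comm_iter a b n') (comm_iter a b n')
  end.

Definition cond_star : Prop :=
  forall a b, compact_con a -> compact_con b ->
  forall n : nat, (1 <= n)%N ->
  exists m : nat, comm (comm_iter a a m) (comm_iter b b m) `<=` comm_iter a b n.

Definition prime_con phi : Prop :=
  phi <> Nabla A /\
  forall a b, comm a b `<=` phi -> a `<=` phi \/ b `<=` phi.

Definition rho t : con A := con_inf [set phi | prime_con phi /\ t `<=` phi].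

Definition compact_closed : Prop :=
  forall a b, compact_con a -> compact_con b -> compact_con (comm a b).

Definition pure_con t : Prop :=
  forall a, compact_con a -> a `<=` t -> con_join t (perp a) = Nabla A.

Lemma comm_primeP phi a b : V A -> prime_con phi ->
  comm a b `<=` phi <-> a `<=` phi \/ b `<=` phi.
Proof.
move=> VA [_ phiP]; split; first exact: phiP.
have [le _] := comm_axioms VA a b.
by case=> h p /le[? ?]; exact: h.
Qed.

Lemma rho_eqP a b : rho a = rho b <->
  forall phi, prime_con phi -> (a `<=` phi <-> b `<=` phi).
Proof.
split=> [e phi phiP|e].
  have h (c : con A) : c `<=` phi <-> rho c `<=` phi.
    split=> [cphi p|h p cp]; first exact.
    by apply: h => psi [_]; exact.
  by rewrite (h a) (h b) e.
by apply: con_eq => p rp phi [phiP /(e _ phiP) ?]; exact: (rp phi).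
Qed.

End OneAlgebra.
End Commutator.

Record kcon (s : signature) (A : algebra s) :=
  KCon { kcon_con :> con A; kconP : compact_con kcon_con }.

Arguments kconP {s A} _.
Arguments compact_join {s A a b} _ _.

HB.instance Definition _ s (A : algebra s) := gen_eqMixin (kcon A).
HB.instance Definition _ s (A : algebra s) := gen_choiceMixin (kcon A).

Section KEquiv.
Variables (s : signature) (V : variety s) (A : algebra s).

Definition kequiv (a b : kcon A) : bool := `[< rho V a = rho V b >].

Lemma kequiv_refl : reflexive kequiv.
Proof. by move=> a; exact/asboolP. Qed.
Lemma kequiv_sym : symmetric kequiv.
Proof. by move=> a b; apply/asboolP/asboolP => ->. Qed.
Lemma kequiv_trans : transitive kequiv.
Proof. by move=> b a c /asboolP ab /asboolP bc; apply/asboolP; rewrite ab. Qed.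

Canonical kequiv_rel := EquivRel kequiv kequiv_refl kequiv_sym kequiv_trans.

End KEquiv.

Fact reticulation_display : Order.disp_t. Proof. exact: (Order.Disp tt tt). Qed.

Section Reticulation.
Variables (s : signature) (V : variety s) (A : algebra s).

(** The carrier only depends on [V] and [A]; the proof arguments are there so
    that the lattice structure below can be attached to the type. *)
Definition reticulation (sV : semidegenerate V) (VA : V A)
  (KA : compact_closed V A) : Type := {eq_quot (kequiv_rel V A)}%qT.

Variables (sV : semidegenerate V) (VA : V A) (KA : compact_closed V A).

Local Notation L := (reticulation sV VA KA).

HB.instance Definition _ := Choice.copy L {eq_quot (kequiv_rel V A)}%qT.

Definition lambda (a : kcon A) : L := \pi_({eq_quot (kequiv_rel V A)})%qT a.

Definition ret_repr (x : L) : kcon A :=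
  repr (x : {eq_quot (kequiv_rel V A)}%qT).

Lemma ret_reprK : cancel ret_repr lambda.
Proof. by move=> x; exact: reprK. Qed.

Lemma lambda_eq (a b : kcon A) : lambda a = lambda b <-> rho V a = rho V b.
Proof.
split=> [/eqmodP/asboolP //|e]; exact/eqmodP/asboolP.
Qed.

Lemma lambdaP (a b : kcon A) : lambda a = lambda b <->
  forall phi : con A, prime_con V phi -> (a `<=` phi <-> b `<=` phi).
Proof. by rewrite lambda_eq; exact: rho_eqP. Qed.

Definition kcomm (a b : kcon A) : kcon A := KCon (KA (kconP a) (kconP b)).
Definition kjoin (a b : kcon A) : kcon A :=
  KCon (compact_join (kconP a) (kconP b)).

Lemma kcommE a b : kcon_con (kcomm a b) = comm V a b. Proof. by []. Qed.
Lemma kjoinE a b : kcon_con (kjoin a b) = con_join a b. Proof. by []. Qed.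

Definition ret_meet (x y : L) : L := lambda (kcomm (ret_repr x) (ret_repr y)).
Definition ret_join (x y : L) : L := lambda (kjoin (ret_repr x) (ret_repr y)).
Definition ret_bot : L := lambda (KCon (@compact_Delta s A)).
Definition ret_top : L := lambda (KCon (compact_Nabla sV VA)).

Lemma lambda_repr a (phi : con A) : prime_con V phi ->
  ret_repr (lambda a) `<=` phi <-> a `<=` phi.
Proof. by move=> phiP; have /lambdaP := ret_reprK (lambda a); exact. Qed.

Lemma lambda_meet a b : ret_meet (lambda a) (lambda b) = lambda (kcomm a b).
Proof.
apply/lambdaP => phi phiP /=; rewrite !comm_primeP //.
by rewrite !lambda_repr.
Qed.

Lemma lambda_join a b : ret_join (lambda a) (lambda b) = lambda (kjoin a b).
Proof. by apply/lambdaP => phi phiP; rewrite !kjoinE !con_joinP !lambda_repr. Qed.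

Lemma ret_ind (P : L -> Prop) : (forall a, P (lambda a)) -> forall x, P x.
Proof. by move=> PL x; rewrite -(ret_reprK x); exact: PL. Qed.

Local Ltac ret_solve :=
  rewrite ?(lambda_meet, lambda_join);
  let phi := fresh "phi" in let phiP := fresh "phiP" in
  apply/lambdaP; intros phi phiP;
  rewrite ?(kcommE, kjoinE, con_joinP, comm_primeP _ _ VA phiP);
  tauto.

Lemma ret_meetC : commutative ret_meet.
Proof. by elim/ret_ind=> a; elim/ret_ind=> b; ret_solve. Qed.
Lemma ret_joinC : commutative ret_join.
Proof. by elim/ret_ind=> a; elim/ret_ind=> b; ret_solve. Qed.
Lemma ret_meetA : associative ret_meet.
Proof.
by elim/ret_ind=> a; elim/ret_ind=> b; elim/ret_ind=> c; ret_solve.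
Qed.
Lemma ret_joinA : associative ret_join.
Proof.
by elim/ret_ind=> a; elim/ret_ind=> b; elim/ret_ind=> c; ret_solve.
Qed.
Lemma ret_joinKI (y x : L) : ret_meet x (ret_join x y) = x.
Proof. by elim/ret_ind: x => a; elim/ret_ind: y => b; ret_solve. Qed.
Lemma ret_meetKU (y x : L) : ret_join x (ret_meet x y) = x.
Proof. by elim/ret_ind: x => a; elim/ret_ind: y => b; ret_solve. Qed.
Lemma ret_meetUl : left_distributive ret_meet ret_join.
Proof.
by elim/ret_ind=> a; elim/ret_ind=> b; elim/ret_ind=> c; ret_solve.
Qed.
Lemma ret_meetxx : idempotent_op ret_meet.
Proof. by elim/ret_ind=> a; ret_solve. Qed.

Definition ret_le (x y : L) : bool := ret_meet x y == x.
Definition ret_lt (x y : L) : bool := (y != x) && ret_le x y.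

HB.instance Definition _ :=
  @Order.isMeetJoinDistrLattice.Build reticulation_display L ret_le ret_lt
    ret_meet ret_join (fun _ _ => erefl) (fun _ _ => erefl)
    ret_meetC ret_joinC ret_meetA ret_joinA ret_joinKI ret_meetKU
    ret_meetUl ret_meetxx.

Lemma ret_le0x (x : L) : (ret_bot <= x)%O.
Proof.
elim/ret_ind: x => a; apply/eqP; rewrite lambda_meet.
apply/lambdaP => phi phiP /=; rewrite (comm_primeP _ _ VA phiP).
by have := @Delta_sub _ _ phi; tauto.
Qed.

Lemma ret_lex1 (x : L) : (x <= ret_top)%O.
Proof.
elim/ret_ind: x => a; apply/eqP; rewrite lambda_meet.
apply/lambdaP => phi phiP /=; rewrite (comm_primeP _ _ VA phiP).
by split=> [[//|h]|]; [exact: subset_trans h|left].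
Qed.

HB.instance Definition _ :=
  Order.hasBottom.Build reticulation_display L ret_le0x.
HB.instance Definition _ :=
  Order.hasTop.Build reticulation_display L ret_lex1.

(** The ideal written [theta^*] on paper *)
Definition star (t : con A) : set L :=
  [set lambda a | a in [set a : kcon A | a `<=` t]].

End Reticulation.

Arguments lambda {s V A} sV VA KA a.
Arguments star {s V A} sV VA KA t.

Section Ideals.
Context {d : Order.disp_t} (L : tbDistrLatticeType d).
Local Open Scope order_scope.

Definition is_ideal (I : set L) : Prop :=
  [/\ I \bot,
      forall x y, x <= y -> I y -> I x &
      forall x y, I x -> I y -> I (x `|` y)].

Definition ideal_sup (F : set (set L)) : set L :=
  \bigcap_(J in [set J | is_ideal J /\ forall I, F I -> (I `<=` J)%classic]) J.

Definition Ann (x : L) : set L := [set y | x `&` y = \bot].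

Definition sigma_ideal (I : set L) : Prop :=
  is_ideal I /\
  forall x, I x -> ideal_sup [set J | J = I \/ J = Ann x] = setT.

Record VId := MkVId { vid_set :> set L; vidP : sigma_ideal vid_set }.

End Ideals.

Record VCon (s : signature) (V : variety s) (A : algebra s) :=
  MkVCon { vcon_con :> con A; vconP : pure_con V vcon_con }.

Record frame (T : Type) := Frame {
  ftop : T;
  fmeet : T -> T -> T;
  fsup : set T -> T;
  fmeetC : commutative fmeet;
  fmeetA : associative fmeet;
  fmeetxx : idempotent_op fmeet;
  fmeet1 : left_id ftop fmeet;
  (* the order is [x <= y] iff [fmeet x y = x] *)
  fsup_lub : forall (S : set T) y,
    fmeet (fsup S) y = fsup S <-> forall x, S x -> fmeet x y = x;
  fmeet_sup : forall x (S : set T), fmeet x (fsup S) = fsup (fmeet x @` S) }.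

Definition frame_iso (T U : Type) (F : frame T) (G : frame U) (h : T -> U) :
    Prop :=
  [/\ bijective h,
      h (ftop F) = ftop G,
      forall x y, h (fmeet F x y) = fmeet G (h x) (h y) &
      forall S : set T, h (fsup F S) = fsup G (h @` S)].

Definition VCon_frame (s : signature) (V : variety s) (A : algebra s)
    (F : frame (VCon V A)) : Prop :=
  [/\ (ftop F : con A) = Nabla A,
      forall t u, (fmeet F t u : con A) = con_meet t u &
      forall S, (fsup F S : con A) = con_sup [set (t : con A) | t in S]].

Definition VId_frame (d : Order.disp_t) (L : tbDistrLatticeType d)
    (F : frame (VId L)) : Prop :=
  [/\ (ftop F : set L) = setT,
      forall I J, (fmeet F I J : set L) = I `&` J &
      forall S, (fsup F S : set L) = ideal_sup [set (I : set L) | I in S]].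

(* Main.v *)
Require Import Defs.
From mathcomp Require Import all_boot all_order.
From mathcomp Require Import boolp classical_sets cardinality.
Import Defs.

(** The congruences of [A], multiplied by [comm], resemble the ideals of a
    commutative ring, and the reticulation only sees them up to their radical.
    So two things have to be shown: that [comm] is arithmetically as good as
    a product of ideals, and that a pure congruence is not changed in an
    essential way by passing to radicals.

    _Arithmetic of the commutator._  Being the greatest operation subject to
    some axioms, [comm] is easy to bound from below and hard to bound from
    above.  The remedy is the algebra [rel_alg b], which is [b] seen as a
    subalgebra of [A * A], with the congruence [diag_con b a] that glues the
    diagonal along [a].  One says that [a] centralizes [b] modulo [d] when [d],
    cut down to [b], is a union of classes of [diag_con b a].  Modularity of
    the congruence lattice of [rel_alg b] enters through the shifting lemma
    [shifting]; it turns centrality into the inclusion [centralizesP] between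
    congruences of [rel_alg b], from which one reads that centrality is
    preserved when [d] grows and is symmetric in [a] and [b]
    ([centralizesC]).  Joins in the first argument cost nothing, since the
    gluing along a join is the join of the gluings.  Hence the least [d]
    modulo which [a] centralizes [b] satisfies the axioms of a commutator,
    while any operation that satisfies them lies below it, as one sees by
    applying the axioms to the second projection of [rel_alg b].  The outcome,
    [comm_subP], is that [comm V a b] is below [d] exactly when [a] centralizes
    [b] modulo [d].  Symmetry, monotony and complete distributivity over joins
    follow at once.  Semidegeneracy makes [Nabla] a unit ([comm_Nabla]): in the
    quotient of [rel_alg b] by [diag_con b Nabla] the diagonal is a one-element
    subalgebra, so that the quotient is trivial.

    _Radicals._  By Zorn's lemma a compact congruence below [rho V t] has a
    commutator power below [t] ([rho_nilpotent]).  Consequently two classes of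
    the reticulation join to the top only if the congruences join to [Nabla],
    and they meet to the bottom only if the commutator is nilpotent.

    _The inverse map._  Sending a sigma-ideal [I] to the join of all the
    compact congruences with class in [I] would be wrong: for the zero ideal
    this is the radical of [Delta], which need not be pure.  The inverse is
    [pure_core I], the join of the congruences [a] such that
    [b \/ perp a = Nabla] for some compact [b] with class in [I]; such an [a]
    is below [b].  To see that [pure_core I] is large enough, take a compact
    [a] with class in [I].  As [I] is a sigma-ideal there are [b] with class
    in [I] and [c] with [b \/ c = Nabla] and [comm V a c] nilpotent.
    The condition [cond_star] replaces the latter by [comm V a' c' = Delta]
    for suitable powers of [a] and [c].  Coprimality survives powers, so
    [b \/ c' = Nabla], and [a'] is one of the congruences that
    generate [pure_core I]; but [a'] and [a] have the same class.  The same
    replacement of a congruence by a power, now for [b] in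
    [b \/ perp a = Nabla], shows that [pure_core I] is pure. *)

Set Implicit Arguments.
Unset Strict Implicit.
Unset Printing Implicit Defensive.

Import Order.TTheory.
Local Open Scope classical_set_scope.

(** * Centrality and the commutator *)

Section SyntacticCongruence.
Variables (s : signature) (A : algebra s).

Inductive unary_poly : (A -> A) -> Prop :=
| unary_poly_id : unary_poly id
| unary_poly_opn (o : sym s) (x : 'I_(arity o) -> A) (i : 'I_(arity o)) f :
    unary_poly f ->
    unary_poly (fun w => f (opn A o [eta x with i |-> w])).

(** The arguments of the operation are changed one at a time, since a unary
    polynomial only sees one of them. *)
Lemma unary_poly_congr (S : set A) (o : sym s) (x y : 'I_(arity o) -> A) :
  (forall i f, unary_poly f -> S (f (x i)) <-> S (f (y i))) ->
  forall f, unary_poly f -> S (f (opn A o x)) <-> S (f (opn A o y)).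
Proof.
move=> xy f fP.
pose z k (i : 'I_(arity o)) := if i < k then y i else x i.
suff zE k : (k <= arity o)%N ->
    S (f (opn A o x)) <-> S (f (opn A o (z k))).
  have -> : y = z (arity o) by apply/funext => i; rewrite /z ltn_ord.
  exact: zE.
elim: k => [_|k IH kn]; first by have -> : x = z 0 by apply/funext.
apply: (iff_trans (IH (ltnW kn))).
pose i0 := Ordinal kn.
have zk : z k = [eta z k with i0 |-> x i0].
  apply/funext => i /=; case: eqVneq => // ->.
  by rewrite /z ltnn.
have zk1 : z k.+1 = [eta z k with i0 |-> y i0].
  apply/funext => i /=; rewrite /z ltnS leq_eqVlt.
  case: (eqVneq i i0) => [-> /=|ne]; first by rewrite eqxx.
  by rewrite (_ : (val i == k) = false) //; exact: negbTE ne.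
rewrite zk zk1.
exact: (xy i0 _ (unary_poly_opn (z k) i0 fP)).
Qed.

(** The syntactic congruence of [S], the greatest congruence that saturates [S].
    It serves to compare joins of congruences with a mere subset: a join of
    congruences saturating [S] is below [syn S], hence saturates [S]. *)
Definition syn (S : set A) : con A.
Proof.
exists [set p | forall f, unary_poly f -> S (f p.1) <-> S (f p.2)] => /=.
- by [].
- by move=> x y xy f fP; apply: iff_sym; exact: xy.
- by move=> x y z xy yz f fP; exact: iff_trans (xy f fP) (yz f fP).
- move=> o x y xy f fP.
  exact: (unary_poly_congr (fun i g gP => xy i g gP) fP).
Defined.

Lemma syn_sat (S : set A) x y : con_rel (syn S) (x, y) -> S x -> S y.
Proof. by move=> /(_ _ unary_poly_id) []. Qed.

(** Such an [R] is carried into itself by every unary polynomial. *)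
Lemma compatible_sub_syn (S : set A) (R : set (A * A)) :
  (forall x, R (x, x)) ->
  (forall (o : sym s) (x y : 'I_(arity o) -> A),
    (forall i, R (x i, y i)) -> R (opn A o x, opn A o y)) ->
  (forall x y, R (x, y) -> S x <-> S y) -> R `<=` syn S.
Proof.
move=> Rxx Ropn RS [x y] Rxy f fP /=.
elim: fP x y Rxy => [|o z i g _ IH] x y Rxy; first exact: RS.
by apply/IH/Ropn => j /=; case: eqP.
Qed.

Lemma con_sub_syn (S : set A) (c : con A) :
  (forall x y, con_rel c (x, y) -> S x -> S y) -> c `<=` syn S.
Proof.
move=> cS; apply: compatible_sub_syn => [x|o x y xy|x y xy].
- exact: con_refl.
- exact: con_comp.
- by split; apply: cS => //; exact: con_sym.
Qed.

End SyntacticCongruence.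

Definition pullback (s : signature) (A B : algebra s) (f : A -> B)
  (fh : is_hom f) (c : con B) : con A.
Proof.
exists [set p | con_rel c (f p.1, f p.2)] => /=.
- by move=> x; exact: con_refl.
- by move=> x y; exact: con_sym.
- by move=> x y z; exact: con_trans.
- by move=> o x y xy; rewrite !fh; exact: con_comp.
Defined.

Section RelAlgebra.
Variables (s : signature) (A : algebra s) (b : con A).

Lemma rel_inh : inhabited {p : A * A | con_rel b p}.
Proof. by case: (alg_inh A) => x; split; exists (x, x); exact: con_refl. Qed.

Lemma rel_opn_subproof (o : sym s)
    (x : 'I_(arity o) -> {p : A * A | con_rel b p}) :
  con_rel b (opn A o (fun i => (sval (x i)).1),
             opn A o (fun i => (sval (x i)).2)).
Proof. by apply: con_comp => i; case: (x i) => -[]. Qed.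

(** A binary product cut down to a congruence, with pairs as elements; it is
    isomorphic to a subalgebra of a power of [A] indexed by [bool], which is
    how [rel_alg_in] places it in the variety. *)
Definition rel_alg : algebra s :=
  @Algebra s {p : A * A | con_rel b p} rel_inh
    (fun o x => exist (fun p => con_rel b p) _ (rel_opn_subproof x)).

Definition rel_pair x y (h : con_rel b (x, y)) : rel_alg :=
  exist (fun p => con_rel b p) _ h.

Definition diag (x : A) : rel_alg := rel_pair (con_refl b x).

Lemma rel_alg_eq (p q : rel_alg) : sval p = sval q -> p = q.
Proof.
case: p q => [p bp] [q bq] /= e; case: q / e bq => bq.
by congr exist; exact: Prop_irrelevance.
Qed.

Lemma rel_algP (p : rel_alg) : con_rel b ((sval p).1, (sval p).2).
Proof. by case: p => -[]. Qed.

Lemma rel_pairE (p : rel_alg) : p = rel_pair (rel_algP p).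
Proof. by apply: rel_alg_eq; rewrite /= -surjective_pairing. Qed.

Lemma diag_hom : is_hom diag.
Proof. by move=> o x; exact: rel_alg_eq. Qed.

Lemma rel_alg_in (V : variety s) : V A -> V rel_alg.
Proof.
move=> VA; pose P := product (fun _ : bool => A).
pose D : set P := [set x | con_rel b (x true, x false)].
have D0 : D !=set0.
  by case: (alg_inh A) => x; exists (fun=> x); exact: con_refl.
have Dop : subuniverse D by move=> o x Dx; apply: con_comp => i; exact: Dx.
pose f (x : subalgebra D0 Dop) : rel_alg := rel_pair (svalP x).
suff [e] : inhabited (epi (subalgebra D0 Dop) rel_alg).
  by apply: (variety_img e); apply: variety_sub; exact: variety_prod.
split; exists f; first by move=> o x; exact: rel_alg_eq.
move=> p; rewrite (rel_pairE p).
have bx : D (fun i => if i then (sval p).1 else (sval p).2) by exact: rel_algP.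
by exists (exist _ _ bx); exact: rel_alg_eq.
Qed.

Definition pr1 : epi rel_alg A.
Proof. by exists (fun p => (sval p).1) => // x; exists (diag x). Defined.

Definition pr2 : epi rel_alg A.
Proof. by exists (fun p => (sval p).2) => // x; exists (diag x). Defined.

(** The congruence that is usually written with a capital delta and the two
    indices [a] and [b]. *)
Definition diag_con (a : con A) : con rel_alg :=
  cg [set (diag p.1, diag p.2) | p in con_rel a].

Lemma diag_con_gen (a : con A) x y :
  con_rel a (x, y) -> con_rel (diag_con a) (diag x, diag y).
Proof. by move=> axy; apply: sub_cg; exists (x, y). Qed.

Lemma diag_con_sub (a : con A) (c : con rel_alg) :
  a `<=` pullback diag_hom c -> diag_con a `<=` c.
Proof. by move=> ac; apply: cg_sub => _ [[x y] axy <-]; exact: ac axy. Qed.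

Lemma diag_con_pr1 (a : con A) : diag_con a `<=` preim pr1 a.
Proof. by apply: diag_con_sub => -[]. Qed.

Lemma diag_con_pr2 (a : con A) : diag_con a `<=` preim pr2 a.
Proof. by apply: diag_con_sub => -[]. Qed.

Definition rel_set (d : con A) : set rel_alg := [set p | con_rel d (sval p)].

End RelAlgebra.

(** Classically, the term condition: if [t(x,u)] and [t(x,v)] are identified by
    [d] then so are [t(y,u)] and [t(y,v)], for [a]-related tuples [x], [y] and
    [b]-related tuples [u], [v].  The pairs [(t(x,u), t(x,v))] and
    [(t(y,u), t(y,v))] are the pairs of elements of [rel_alg b] that generate
    [diag_con b a] as an equivalence. *)
Definition centralizes (s : signature) (A : algebra s) (a b d : con A) : Prop :=
  forall p q : rel_alg b, con_rel (diag_con b a) (p, q) ->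
    con_rel d (sval p) -> con_rel d (sval q).

Section Centralizes.
Variable s : signature.
Implicit Types A B : algebra s.

Lemma centralizes_syn A (a b d : con A) :
  centralizes a b d <-> diag_con b a `<=` syn (rel_set d).
Proof.
split=> [C|C p q /C]; last exact: syn_sat.
by apply: con_sub_syn => p q; exact: C.
Qed.

(** Those [x], [y] for which [diag x] and [diag y] are syntactically congruent
    form a congruence of [A]; it contains each member of [S], hence the join. *)
Lemma centralizes_sup A (S : set (con A)) (b d : con A) :
  (forall a, S a -> centralizes a b d) -> centralizes (con_sup S) b d.
Proof.
move=> C; apply/centralizes_syn/diag_con_sub/con_supP => a.
move=> /C/centralizes_syn aS.
by move=> [x y] axy; apply/aS/diag_con_gen.
Qed.

Lemma centralizes_pullback A B (f : A -> B) (fh : is_hom f)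
    (a b d : con A) (a' b' d' : con B) :
  a `<=` pullback fh a' -> b `<=` pullback fh b' -> d = pullback fh d' ->
  centralizes a' b' d' -> centralizes a b d.
Proof.
move=> aa bb -> C p q.
pose g (p : rel_alg b) : rel_alg b' :=
  @rel_pair _ _ b' _ _ (bb _ (rel_algP p)).
have gh : is_hom g by move=> o x; apply: rel_alg_eq; rewrite /= !fh.
have le : diag_con b a `<=` pullback gh (diag_con b' a').
  apply: diag_con_sub => -[x y] /aa axy /=.
  have gd z : g (diag b z) = diag b' (f z) by exact: rel_alg_eq.
  by rewrite !gd; exact: diag_con_gen.
by move=> /le /C /=; case: (sval p) (sval q) => [? ?] [].
Qed.

Lemma centralizes_mono A (a b d a' b' : con A) :
  a `<=` a' -> b `<=` b' -> centralizes a' b' d -> centralizes a b d.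
Proof.
have idh : is_hom (@id A) by [].
move=> aa bb; apply: (@centralizes_pullback _ _ _ idh _ _ _ a' b' d).
- by move=> [x y]; exact: aa.
- by move=> [x y]; exact: bb.
- by apply: con_eq => -[].
Qed.

Lemma centralizes_self A (a b : con A) : centralizes a b a.
Proof.
move=> p q pq; move: (diag_con_pr1 pq) (diag_con_pr2 pq).
case: (p) (q) => [[x y] bxy] [[u v] buv] /= au av axy.
apply: con_trans (con_trans _ av); last exact: axy.
exact: con_sym.
Qed.

Lemma centralizes_sub A (k b d : con A) : k `<=` d -> centralizes k b d.
Proof.
move=> kd p q pq; move: (diag_con_pr1 pq) (diag_con_pr2 pq).
case: (p) (q) => [[x y] bxy] [[u v] buv] /= /kd ku /kd kv dxy.
apply: con_trans (con_trans _ kv); last exact: dxy.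
exact: con_sym.
Qed.

Lemma centralizes_join A (a a' b d : con A) :
  centralizes a b d -> centralizes a' b d -> centralizes (con_join a a') b d.
Proof.
move=> C C'; have [_] := con_joinP a a' (con_sup [set a; a']).
move=> le; apply: (@centralizes_mono _ _ _ _ (con_sup [set a; a']) b) => //.
  by apply: le; split; apply: con_sup_ub; [left|right].
by apply: centralizes_sup => _ [] ->.
Qed.

(** The congruence glued along [a] in [B] lies in the image of the one glued
    along the preimage of [a] in [A], and computing in [B] amounts to
    computing in [A] modulo the kernel.  This kernel saturates the preimage of
    [d], and so does its join with the glued congruence. *)
Lemma centralizes_push A B (f : epi A B) (a b d : con B) :
  centralizes (preim f a) (preim f b) (preim f d) -> centralizes a b d.
Proof.
move=> C.
pose g (p : rel_alg (preim f b)) : rel_alg b :=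
  @rel_pair _ _ b _ _ (rel_algP p).
have gh : is_hom g by move=> o x; apply: rel_alg_eq; rewrite /= !(epi_hom f).
have gs q : exists p, g p = q.
  have [x xE] := epi_surj f (sval q).1; have [y yE] := epi_surj f (sval q).2.
  have bxy : con_rel (preim f b) (x, y) by rewrite /= xE yE; exact: rel_algP.
  exists (rel_pair bxy); apply: rel_alg_eq.
  by rewrite /= xE yE -surjective_pairing.
pose F := Epi gh gs.
have le : diag_con b a `<=` push F (diag_con _ (preim f a)).
  apply: diag_con_sub => -[u v] auv.
  have [x xE] := epi_surj f u; have [y yE] := epi_surj f v.
  exists (diag _ x, diag _ y).
    by apply: con_joinl; apply: diag_con_gen; rewrite /= xE yE.
  by congr pair; apply: rel_alg_eq; rewrite /= ?xE ?yE.
move=> p q /le [[x y] xy [<- <-]].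
case: (x) (y) xy => [[x1 x2] hx] [[y1 y2] hy] xy.
have /(_ _ xy) : con_join (diag_con _ (preim f a)) (ker F) `<=`
    syn (rel_set (preim f d)).
  apply/con_joinP; split; first exact/centralizes_syn.
  apply: con_sub_syn => p0 q0 /(congr1 sval)[e1 e2].
  by rewrite /rel_set /= e1 e2.
exact: syn_sat.
Qed.

End Centralizes.

Section Modular.
Variables (s : signature) (V : variety s).
Hypothesis modV : congruence_modular V.

(** The pairs [(x, y)] and [(u, v)] are opposite [a]-sides of a rectangle whose
    other two sides are in [b], and a [c]-link is shifted from one to the other.
    Indeed [(u, v)] lies in [((a /\ c) \/ b) /\ a], which the modular law
    rewrites as [(a /\ c) \/ (b /\ a)]. *)
Lemma shifting (A : algebra s) (a b c : con A) x y u v : V A ->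
  con_meet a b `<=` c -> con_rel a (x, y) -> con_rel a (u, v) ->
  con_rel b (x, u) -> con_rel b (y, v) -> con_rel c (x, y) -> con_rel c (u, v).
Proof.
move=> VA abc axy auv bxu byv cxy.
have aca : con_meet a c `<=` a by move=> p [].
have E := modV VA b aca.
have : con_rel (con_meet (con_join (con_meet a c) b) a) (u, v).
  split=> //; apply: (@con_trans _ _ _ u x).
    by apply: con_joinr; exact: con_sym.
  apply: (@con_trans _ _ _ x y); first by apply: con_joinl; split.
  exact: con_joinr.
rewrite E; apply: (iffRL (con_joinP _ _ _)); split=> p [] //.
by move=> bp ap; apply: abc.
Qed.

(** Centrality becomes an inclusion, in which [d] only occurs on the right.
    Both directions are instances of the shifting lemma. *)
Lemma centralizesP (A : algebra s) (a b d : con A) : V A ->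
  centralizes a b d <->
  con_meet (ker (pr1 b)) (diag_con b a) `<=` preim (pr2 b) d.
Proof.
move=> VA; have VR := rel_alg_in b VA; split=> [C|le p q pq dp].
- move=> [p q] [/= pq1 pq].
  have b12 : con_rel b ((sval p).2, (sval q).2).
    apply: con_trans (rel_algP q); rewrite -pq1; exact/con_sym/rel_algP.
  (* Shift the link from [p], [q] to a pair that starts on the diagonal. *)
  have : con_rel (diag_con b a) (diag b (sval p).2, rel_pair b12).
    apply: (@shifting _ (ker (pr1 b)) (ker (pr2 b)) _ p q _ _ VR) => //.
    move=> [p' q'] [/= e1 e2].
    rewrite (_ : p' = q'); first exact: (con_refl (diag_con b a)).
    by apply: rel_alg_eq; case: (sval p') (sval q') e1 e2 => ? ? [? ?] /= -> ->.
  by move/C; apply; exact: con_refl.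
- (* The same sides, now joined by [diag_con b a], and with a [d]-link. *)
  have := shifting (u := diag b (sval q).1) (v := q) VR le _ _ _ pq _.
  move=> /(_ (diag b (sval p).1)) /=.
  rewrite -!surjective_pairing; apply=> //.
  by apply: diag_con_gen; exact: (diag_con_pr1 pq).
Qed.

Lemma centralizes_up (A : algebra s) (a b d d' : con A) : V A ->
  d `<=` d' -> centralizes a b d -> centralizes a b d'.
Proof.
move=> VA dd' /(centralizesP _ _ _ VA) C; apply/(centralizesP _ _ _ VA).
by move=> p /C; exact: dd'.
Qed.

(** The transposes of the links of [diag_con b a] form a compatible relation on
    [rel_alg a] that contains the generators of [diag_con a b]; it need not be
    transitive.  Shifting along [diag_con b a], inside [rel_alg b], shows that
    a transposed link carries membership in [d] from one end to the other. *)
Lemma centralizesC (A : algebra s) (a b d : con A) : V A ->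
  centralizes a b d -> centralizes b a d.
Proof.
move=> VA /(centralizesP _ _ _ VA) C; have VR := rel_alg_in b VA.
pose T (p q : rel_alg a) := exists P Q : rel_alg b,
  [/\ sval P = ((sval p).1, (sval q).1), sval Q = ((sval p).2, (sval q).2) &
      con_rel (diag_con b a) (P, Q)].
have Tr p : T p p.
  by exists (diag _ (sval p).1), (diag _ (sval p).2); split=> //;
    apply: diag_con_gen; exact: rel_algP.
have To (o : sym s) (x y : 'I_(arity o) -> rel_alg a) :
    (forall i, T (x i) (y i)) -> T (opn _ o x) (opn _ o y).
  move=> /(@choice _ _ _)[P /(@choice _ _ _)[Q PQ]].
  exists (opn _ o P), (opn _ o Q); split.
  - by congr pair; congr (opn A o _); apply/funext => i; have [-> _ _] := PQ i.
  - by congr pair; congr (opn A o _); apply/funext => i; have [_ -> _] := PQ i.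
  - by apply: (con_comp (c := diag_con b a)) => i; have [] := PQ i.
have Ts p q : T p q -> con_rel d (sval p) -> con_rel d (sval q).
  move=> [P [Q [EP EQ PQ]]] dp.
  have C' : con_meet (diag_con b a) (ker (pr1 b)) `<=` preim (pr2 b) d.
    by move=> r [r1 r2]; apply: C.
  have := shifting (x := diag b (sval p).1) (y := diag b (sval p).2)
    (u := P) (v := Q) VR C' _ PQ.
  rewrite /= EP EQ /= -!surjective_pairing; apply=> //.
  by apply: diag_con_gen; exact: rel_algP.
(* Symmetrizing [T] replaces a second shift, back from [q] to [p]. *)
pose R := [set pq : rel_alg a * rel_alg a | T pq.1 pq.2 /\ T pq.2 pq.1].
have RS : R `<=` syn (rel_set d).
  apply: compatible_sub_syn => [p|o x y xy|p q [pq qp]].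
  - by split; exact: Tr.
  - by split; apply: To => i; case: (xy i).
  - by split; exact: Ts.
apply/centralizes_syn/diag_con_sub => -[x y] bxy; apply: RS; split.
- by exists (rel_pair bxy), (rel_pair bxy); split=> //; exact: con_refl.
- have byx := con_sym bxy.
  by exists (rel_pair byx), (rel_pair byx); split=> //; exact: con_refl.
Qed.

Definition centr_comm (A : algebra s) (a b : con A) : con A :=
  con_inf [set d | centralizes a b d].

Lemma centr_comm_centralizes (A : algebra s) (a b : con A) :
  centralizes a b (centr_comm a b).
Proof. by move=> p q pq dp d Cd; apply: (Cd _ _ pq); exact: dp. Qed.

Lemma centr_comm_sub (A : algebra s) (a b d : con A) :
  centralizes a b d -> centr_comm a b `<=` d.
Proof. by move=> Cd p; exact. Qed.

(** The nontrivial inclusion asks that [push f a] centralize [push f b] modulo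
    the image of [centr_comm a b].  Pulled back to [A], this says that
    [a \/ ker f] centralizes [b \/ ker f] modulo a congruence above [ker f].
    Joining [ker f] to the first argument is harmless, and symmetry makes it
    harmless in the second one. *)
Lemma centr_comm_axioms : commutator_axioms V centr_comm.
Proof.
move=> A VA a b; split.
  rewrite subsetI; split; apply: centr_comm_sub; first exact: centralizes_self.
  by move=> p q _ _; rewrite (surjective_pairing (sval q)); exact: rel_algP.
move=> B VB f; apply: con_eq.
  apply/con_joinP; split; last exact: ker_sub_preim.
  apply: centr_comm_sub; apply: (@centralizes_pullback _ _ _ f (epi_hom f) _ _ _
    (push f a) (push f b) _ _ _ _ (@centr_comm_centralizes _ _ _)).
  - by case=> x y /(con_joinl (b := ker f)); rewrite -preim_push.
  - by case=> x y /(con_joinl (b := ker f)); rewrite -preim_push.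
  - by apply: con_eq.
rewrite -preim_push.
suff le : centr_comm (push f a) (push f b) `<=` push f (centr_comm a b).
  by move=> p /le.
apply/centr_comm_sub/(@centralizes_push _ _ _ f); rewrite !preim_push.
set d := con_join (centr_comm a b) _.
have kd : ker f `<=` d by exact: con_joinr.
have ad : centralizes a b d.
  apply: centralizes_up (@centr_comm_centralizes _ a b) => //.
  exact: con_joinl.
apply: centralizes_join; last exact: centralizes_sub.
apply: centralizesC => //; apply: centralizes_join; last exact: centralizes_sub.
exact: centralizesC.
Qed.

Lemma push_diag_con (A : algebra s) (a b : con A) :
  push (pr2 b) (diag_con b a) = a.
Proof.
apply: con_eq => [uv [[p q] pq <-]|[x y] axy].
  have /(_ _ pq) : con_join (diag_con b a) (ker (pr2 b)) `<=` preim (pr2 b) a.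
    by apply/con_joinP; split; [exact: diag_con_pr2|exact: ker_sub_preim].
  by [].
exists (diag b x, diag b y) => //; exact/con_joinl/diag_con_gen.
Qed.

Lemma push_ker_pr1 (A : algebra s) (b : con A) : push (pr2 b) (ker (pr1 b)) = b.
Proof.
apply: con_eq => [uv [[p q] pq <-]|[x y] bxy].
  have /(_ _ pq) : con_join (ker (pr1 b)) (ker (pr2 b)) `<=` preim (pr2 b) b.
    apply/con_joinP; split; last exact: ker_sub_preim.
    move=> [p0 q0] /= e; apply: con_trans (rel_algP q0).
    by rewrite -e; exact/con_sym/rel_algP.
  by [].
by exists (diag b x, rel_pair bxy) => //; apply: con_joinl.
Qed.

(** The axioms are applied to [pr2 b], which sends [diag_con b a] to [a] and
    [ker (pr1 b)] to [b].  So [comm V a b] is the image of the commutator of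
    these two congruences, which is contained in their intersection, and
    [centralizesP] bounds the latter. *)
Lemma comm_sub (A : algebra s) (a b d : con A) : V A -> centralizes a b d ->
  comm V a b `<=` d.
Proof.
move=> VA /(centralizesP _ _ _ VA) C.
have VR := rel_alg_in b VA.
have [le /(_ A VA (pr2 b))] := comm_axioms VR (diag_con b a) (ker (pr1 b)).
rewrite push_diag_con push_ker_pr1 => E.
have sub : preim (pr2 b) (comm V a b) `<=` preim (pr2 b) d.
  rewrite -E; apply/con_joinP; split; last exact: ker_sub_preim.
  by move=> p /le [p1 p2]; apply: C.
move=> [x y] cxy.
have bxy : con_rel b (x, y) by have [/(_ _ cxy) []] := comm_axioms VA a b.
exact: (sub (diag b x, rel_pair bxy)).
Qed.

Lemma comm_subP (A : algebra s) (a b d : con A) : V A ->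
  comm V a b `<=` d <-> centralizes a b d.
Proof.
move=> VA; split=> [le|]; last exact: comm_sub.
apply: centralizes_up (@centr_comm_centralizes _ a b) => //.
by apply: subset_trans le; exact: (comm_greatest centr_comm_axioms).
Qed.

End Modular.

(** * Compact congruences, commutator powers and primes *)

Section CompactCongruences.
Variables (s : signature) (A : algebra s).
Implicit Types (a b c : con A) (P : set (con A)).

Lemma compact_le a b :
  (forall c, compact_con c -> c `<=` a -> c `<=` b) -> a `<=` b.
Proof.
move=> ab p ap; apply: (ab (cg [set p])).
- exact/compact_cg/finite_set1.
- by apply: cg_sub => _ ->.
- exact: sub_cg.
Qed.

Lemma compact_le_sup P a : P !=set0 ->
  (forall b c, P b -> P c -> exists2 d, P d & b `<=` d /\ c `<=` d) ->
  compact_con a -> a `<=` con_sup P -> exists2 b, P b & a `<=` b.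
Proof.
move=> [b0 Pb0] dirP ca /ca[F [finF FP aF]].
suff [b Pb Fb] : exists2 b, P b & forall c, F c -> c `<=` b.
  by exists b => //; apply: (subset_trans aF); exact/con_supP.
have /finite_seqP[t tF] : finite_set (F : set {classic con A}) by [].
have {}FP (c : {classic con A}) : c \in t -> P c.
  by move=> ct; apply: FP; rewrite tF.
suff [b Pb tb] : exists2 b, P b &
    forall c : {classic con A}, c \in t -> (c : con A) `<=` b.
  by exists b => // c Fc; apply: tb; rewrite tF in Fc.
elim: t FP {tF} => [|c t IH] tP; first by exists b0.
have [|b Pb tb] := IH; first by move=> d dt; apply: tP; rewrite inE dt orbT.
have [|d Pd [bd cd]] := dirP b c Pb; first by apply: tP; rewrite inE eqxx.
exists d => // e; rewrite inE => /orP[/eqP ->//|/tb eb].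
exact: subset_trans bd.
Qed.

Lemma con_joinC a b : con_join a b = con_join b a.
Proof.
by apply: con_eq; apply/con_joinP; split;
  [exact: con_joinr|exact: con_joinl|exact: con_joinr|exact: con_joinl].
Qed.

Lemma con_join_le a b a' b' :
  a `<=` a' -> b `<=` b' -> con_join a b `<=` con_join a' b'.
Proof.
move=> aa bb; apply/con_joinP; split.
  by apply: (subset_trans aa); exact: con_joinl.
by apply: (subset_trans bb); exact: con_joinr.
Qed.

Lemma con_eqT a : Nabla A `<=` a -> a = Nabla A.
Proof. by move=> h; exact: con_eq. Qed.

Lemma con_join_eqT a b a' b' : a `<=` a' -> b `<=` b' ->
  con_join a b = Nabla A -> con_join a' b' = Nabla A.
Proof.
move=> aa bb e; apply: con_eqT; rewrite -e; exact: con_join_le.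
Qed.

(** The joins of a compact part of [a] and a compact part of [b] form a directed
    family with join [a \/ b]. *)
Lemma Nabla_join_compact a b :
  compact_con (Nabla A) -> con_join a b = Nabla A ->
  exists c d, [/\ compact_con c, compact_con d, c `<=` a, d `<=` b &
    con_join c d = Nabla A].
Proof.
move=> cN abN.
pose P := [set e | exists c d, [/\ compact_con c, compact_con d, c `<=` a,
  d `<=` b & con_join c d = e]].
have [||| _ [c [d [cc cd ca db <-]]] N] := @compact_le_sup P _ _ _ cN.
- exists (con_join (Delta A) (Delta A)), (Delta A), (Delta A).
  by split=> //; [exact: compact_Delta|exact: compact_Delta
                 |exact: Delta_sub|exact: Delta_sub].
- move=> _ _ [c [d [cc cd ca db <-]]] [c' [d' [cc' cd' ca' db' <-]]].
  exists (con_join (con_join c c') (con_join d d')).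
    exists (con_join c c'), (con_join d d').
    by split=> //; [exact: compact_join|exact: compact_join
                   |exact/con_joinP|exact/con_joinP].
  by split; apply: con_join_le;
    [exact: con_joinl|exact: con_joinl|exact: con_joinr|exact: con_joinr].
- rewrite -abN; apply/con_joinP.
  split; apply: compact_le => c cc cle.
    apply: (subset_trans (@con_joinl _ _ c (Delta A))); apply: con_sup_ub.
    exists c, (Delta A).
    by split=> //; [exact: compact_Delta|exact: Delta_sub].
  apply: (subset_trans (@con_joinr _ _ (Delta A) c)); apply: con_sup_ub.
  exists (Delta A), c.
  by split=> //; [exact: compact_Delta|exact: Delta_sub].
- by exists c, d; split=> //; exact: con_eqT.
Qed.

End CompactCongruences.

Section Commutator.
Variables (s : signature) (V : variety s).
Hypotheses (modV : congruence_modular V) (sdV : semidegenerate V).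
Variable A : algebra s.
Hypothesis VA : V A.
Implicit Types a b c d t : con A.

Lemma commC a b : comm V a b = comm V b a.
Proof.
by apply: con_eq; apply/(comm_subP modV _ _ _ VA)/(centralizesC modV VA);
  apply/(comm_subP modV _ _ _ VA).
Qed.

Lemma comm_subl a b : comm V a b `<=` a.
Proof. by have [h _] := comm_axioms VA a b => p /h[]. Qed.

Lemma comm_subr a b : comm V a b `<=` b.
Proof. by have [h _] := comm_axioms VA a b => p /h[]. Qed.

Lemma comm_mono a b a' b' :
  a `<=` a' -> b `<=` b' -> comm V a b `<=` comm V a' b'.
Proof.
move=> aa bb; apply/(comm_subP modV _ _ _ VA)/(centralizes_mono aa bb).
exact/(comm_subP modV _ _ _ VA).
Qed.

Lemma comm_supl (S : set (con A)) b d :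
  (forall a, S a -> comm V a b `<=` d) -> comm V (con_sup S) b `<=` d.
Proof.
move=> Sd; apply/(comm_subP modV _ _ _ VA)/centralizes_sup => a /Sd.
by move/(comm_subP modV _ _ _ VA).
Qed.

Lemma comm_joinl a a' b d :
  comm V a b `<=` d -> comm V a' b `<=` d -> comm V (con_join a a') b `<=` d.
Proof.
move=> /(comm_subP modV _ _ _ VA) C /(comm_subP modV _ _ _ VA) C'.
exact/(comm_subP modV _ _ _ VA)/centralizes_join.
Qed.

(** Cut down to [a], [comm V (Nabla A) a] is a union of classes of
    [diag_con a (Nabla A)], one of which contains the diagonal.  In the
    quotient this class is a one-element subalgebra, so the quotient is trivial
    and all of [a] lies in the class of the diagonal. *)
Lemma comm_Nabla a : comm V a (Nabla A) = a.
Proof.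
rewrite commC; apply: con_eq; first exact: comm_subr.
have /(comm_subP modV _ _ _ VA) C := @subset_refl _ (comm V (Nabla A) a).
case: (alg_inh A) => x0 [x y] axy.
pose Q := quotient (diag_con a (Nabla A)).
pose pr := @quot_proj _ _ (diag_con a (Nabla A)).
have VQ : V Q := variety_img (quot_epi _) (rel_alg_in a VA).
have triv : trivial Q.
  apply: contrapT => /(sdV VQ); apply; exists (pr (diag a x0)) => o X Xx.
  have -> : X = pr \o (fun=> diag a x0) by apply/funext => i; exact: Xx.
  apply: (etrans (esym (quot_proj_hom _ (fun=> diag a x0)))).
  by apply/quot_projP; rewrite -diag_hom; exact: diag_con_gen.
have := triv (pr (diag a x)) (pr (rel_pair axy)).
by move/quot_projP/C; apply; exact: con_refl.
Qed.

(** Expand [comm (t \/ a) (t \/ b)], which is [Nabla] as [Nabla] is a unit. *)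
Lemma comm_coprime t a b :
  con_join t a = Nabla A -> con_join t b = Nabla A ->
  con_join t (comm V a b) = Nabla A.
Proof.
move=> ta tb; apply: con_eqT.
rewrite -{1}(comm_Nabla (Nabla A)) -{1}ta -tb.
apply: comm_joinl.
  by apply: (subset_trans (@comm_subl _ _)); exact: con_joinl.
rewrite (commC a (con_join t b)); apply: comm_joinl.
  by apply: (subset_trans (@comm_subl _ _)); exact: con_joinl.
by rewrite (commC b a); exact: con_joinr.
Qed.

Lemma comm_perp a : comm V a (perp V a) = Delta A.
Proof.
apply: con_eq; last exact: Delta_sub.
by rewrite commC; apply: comm_supl => c ac; rewrite commC ac.
Qed.

Lemma perpP a c : c `<=` perp V a <-> comm V a c = Delta A.
Proof.
split=> [ca|e]; last exact: con_sup_ub.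
apply: con_eq; last exact: Delta_sub.
by rewrite -(comm_perp a); exact: comm_mono.
Qed.

Lemma perp_anti a b : a `<=` b -> perp V b `<=` perp V a.
Proof.
move=> ab; apply/perpP/con_eq; last exact: Delta_sub.
by rewrite -(comm_perp b); exact: comm_mono.
Qed.

Lemma perp_join a b :
  comm V (perp V a) (perp V b) `<=` perp V (con_join a b).
Proof.
apply/perpP/con_eq; last exact: Delta_sub.
apply: comm_joinl.
  by rewrite -(comm_perp a); apply: comm_mono => //; exact: comm_subl.
by rewrite -(comm_perp b); apply: comm_mono => //; exact: comm_subr.
Qed.

Lemma perp_join_coprime t a b :
  con_join t (perp V a) = Nabla A -> con_join t (perp V b) = Nabla A ->
  con_join t (perp V (con_join a b)) = Nabla A.
Proof.
move=> ta tb; apply: con_join_eqT (comm_coprime ta tb) => //.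
exact: perp_join.
Qed.

(** Because [a] is [comm a (t \/ perp a)] and the second summand contributes
    [Delta]. *)
Lemma perp_coprime_sub t a : con_join t (perp V a) = Nabla A -> a `<=` t.
Proof.
move=> ta; rewrite -(comm_Nabla a) -ta commC; apply: comm_joinl.
  exact: comm_subl.
by rewrite commC comm_perp; exact: Delta_sub.
Qed.

Lemma comm_iterS a n :
  comm_iter V a a n.+1 = comm V (comm_iter V a a n) (comm_iter V a a n).
Proof. by case: n. Qed.

(** The numbering of the iterates of two distinct congruences starts one step
    before that of the iterates of their commutator. *)
Lemma comm_iter_comm a b n :
  comm_iter V a b n.+1 = comm_iter V (comm V a b) (comm V a b) n.
Proof. by elim: n => // n IH; rewrite comm_iterS -IH. Qed.

Lemma comm_iter_anti a n m :
  (n <= m)%N -> comm_iter V a a m `<=` comm_iter V a a n.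
Proof.
move=> /subnK <-; elim: (m - n)%N => // k IH.
by rewrite addSn comm_iterS; apply: (subset_trans (@comm_subl _ _)).
Qed.

Lemma comm_iter_Nabla n : comm_iter V (Nabla A) (Nabla A) n = Nabla A.
Proof. by elim: n => // n IH; rewrite comm_iterS IH comm_Nabla. Qed.

Lemma comm_iter_coprime t a n :
  con_join t a = Nabla A -> con_join t (comm_iter V a a n) = Nabla A.
Proof.
by move=> ta; elim: n => // n IH; rewrite comm_iterS; exact: comm_coprime.
Qed.

Lemma comm_iter_prime a n phi : prime_con V phi ->
  comm_iter V a a n `<=` phi <-> a `<=` phi.
Proof.
move=> phiP; elim: n => // n IH.
by rewrite comm_iterS (comm_primeP _ _ VA phiP) IH; tauto.
Qed.

Hypothesis KA : compact_closed V A.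

Lemma comm_iter_compact a n :
  compact_con a -> compact_con (comm_iter V a a n).
Proof. by move=> ca; elim: n => // n IH; rewrite comm_iterS; exact: KA. Qed.

(** The argument of commutative algebra: let [phi] be maximal among the
    congruences above [t] that contain no power of [a].  If neither [b] nor [c]
    is below [phi], then [phi \/ b] and [phi \/ c] both contain some power of
    [a], and the next power is below [phi \/ comm V b c]. *)
Lemma exists_prime a t : compact_con a ->
  (forall n, ~ comm_iter V a a n `<=` t) ->
  exists phi, [/\ prime_con V phi, t `<=` phi & ~ a `<=` phi].
Proof.
move=> ca at_.
pose T := {phi : con A | t `<=` phi /\ forall n, ~ comm_iter V a a n `<=` phi}.
pose R (x y : T) := `[< sval x `<=` sval y >].
have [||||[phi [tphi aphi]] max] := @Zorn T R.
- by move=> x; exact/asboolP.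
- by move=> x y z /asboolP xy /asboolP yz; apply/asboolP/(subset_trans xy).
- move=> [x hx] [y hy] /asboolP/= xy /asboolP/= yx.
  by apply: eq_exist; exact: con_eq.
- move=> C totC.
  pose P := [set t] `|` [set sval x | x in C].
  have tP : t `<=` con_sup P by apply: con_sup_ub; left.
  have nP n : ~ comm_iter V a a n `<=` con_sup P.
    have P0 : P !=set0 by exists t; left.
    have PE b : P b -> b = t \/ exists2 x, C x & sval x = b by [].
    have dirP b c : P b -> P c -> exists2 d, P d & b `<=` d /\ c `<=` d.
      move=> /PE[->|[x Cx <-]] /PE[->|[y Cy <-]].
      + by exists t; [left|split].
      + by exists (sval y); [right; exists y|split=> //; case: (svalP y)].
      + by exists (sval x); [right; exists x|split=> //; case: (svalP x)].
      + have [/asboolP xy|/asboolP yx] := totC x y Cx Cy.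
          by exists (sval y); [right; exists y|split].
        by exists (sval x); [right; exists x|split].
    move=> /(compact_le_sup P0 dirP (comm_iter_compact ca))[b /PE[->|]].
      exact: at_.
    by case=> -[x [tx nx]] Cx <-; exact: nx.
  exists (exist _ (con_sup P) (conj tP nP)) => x Cx; apply/asboolP => /=.
  by apply: con_sup_ub; right; exists x.
have grow c : ~ c `<=` phi -> exists n, comm_iter V a a n `<=` con_join phi c.
  move=> cphi; apply: contrapT => /forallNP nc; apply: cphi.
  have centr_comm : t `<=` con_join phi c.
    by apply: (subset_trans tphi); exact: con_joinl.
  have /max/(congr1 sval)/= <- :
      R (exist _ phi (conj tphi aphi)) (exist _ _ (conj centr_comm nc)).
    by apply/asboolP; exact: con_joinl.
  exact: con_joinr.
exists phi; split=> //; last exact: (aphi 0).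
split=> [e|b c bc]; first by apply: (aphi 0); rewrite e.
apply: contrapT => /not_orP[/grow[n bn] /grow[m cm]].
apply: (aphi (maxn n m).+1); rewrite comm_iterS.
have {}bn := subset_trans (@comm_iter_anti a _ _ (leq_maxl n m)) bn.
have {}cm := subset_trans (@comm_iter_anti a _ _ (leq_maxr n m)) cm.
apply: (subset_trans (comm_mono bn cm)).
apply: comm_joinl; first exact: comm_subl.
rewrite commC; apply: comm_joinl; first exact: comm_subl.
by rewrite commC.
Qed.

Lemma rho_nilpotent a t : compact_con a -> a `<=` rho V t ->
  exists n, comm_iter V a a n `<=` t.
Proof.
move=> ca art; apply: contrapT => /forallNP/(exists_prime ca)[phi [phiP tphi]].
by apply=> p /art; exact.
Qed.

End Commutator.

(** * The frame of sigma-ideals *)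

(** Both frames of the theorem consist of sets ordered by inclusion, with
    intersection as meet. *)
Lemma frame_of_sets (T X : Type) (r : T -> set X) (top : T)
    (meet : T -> T -> T) (sup : set T -> T) :
  injective r ->
  r top = setT ->
  (forall x y, r (meet x y) = r x `&` r y) ->
  (forall S y, r (sup S) `<=` r y <-> forall x, S x -> r x `<=` r y) ->
  (forall x S, r x `&` r (sup S) `<=` r (sup (meet x @` S))) ->
  exists F : frame T, [/\ ftop F = top, fmeet F = meet & fsup F = sup].
Proof.
move=> rI rT rM rS rD.
have leE x y : meet x y = x <-> r x `<=` r y.
  split=> [<-|xy]; first by rewrite rM; exact: subIsetr.
  by apply: rI; rewrite rM; exact/setIidPl.
have mC : commutative meet by move=> x y; apply: rI; rewrite !rM setIC.
have mA : associative meet by move=> x y z; apply: rI; rewrite !rM setIA.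
have mxx : idempotent_op meet by move=> x; apply: rI; rewrite rM setIid.
have m1 : left_id top meet by move=> x; apply: rI; rewrite rM rT setTI.
have lub S y : meet (sup S) y = sup S <-> forall x, S x -> meet x y = x.
  rewrite leE rS.
  by split=> h x Sx; apply/leE; exact: h.
have dist x S : meet x (sup S) = sup (meet x @` S).
  apply: rI; apply/seteqP; split; first by rewrite rM; exact: rD.
  apply/rS => _ [y Sy <-]; rewrite !rM; apply: setIS.
  by have /rS := @subset_refl _ (r (sup S)); exact.
by exists (Frame mC mA mxx m1 lub dist).
Qed.

Section SigmaIdeals.
Context {disp : Order.disp_t} (L : tbDistrLatticeType disp).
Implicit Types (I J : set L) (F : set (set L)).

Lemma ideal_sup_ideal F : is_ideal (ideal_sup F).
Proof.
split.
- by move=> J [[J0 _ _] _].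
- by move=> x y xy Fy J JF; case: (JF) => -[_ h _] _; exact: h xy (Fy J JF).
- move=> x y Fx Fy J JF; case: (JF) => -[_ _ h] _.
  exact: h (Fx J JF) (Fy J JF).
Qed.

Lemma ideal_sup_ub F I : F I -> I `<=` ideal_sup F.
Proof. by move=> FI x Ix J [_ FJ]; exact: (FJ I FI). Qed.

Lemma ideal_sup_sub F J :
  is_ideal J -> (forall I, F I -> I `<=` J) -> ideal_sup F `<=` J.
Proof. by move=> idJ FJ x; apply; split. Qed.

Lemma ideal_topP I : is_ideal I -> I \top%O -> I = setT.
Proof.
by case=> _ h _ IT; apply/seteqP; split=> // x _; apply: h IT; exact: lex1.
Qed.

(** The elements below some [y \/ z], with [y] in [I] and [z] in [Ann x], form
    an ideal, so [I] and [Ann x] can only join to the whole lattice if the top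
    is one of them. *)
Lemma sigma_idealP I : is_ideal I ->
  sigma_ideal I <-> forall x, I x -> exists y z,
    [/\ I y, (x `&` z = \bot)%O & (y `|` z = \top)%O].
Proof.
move=> idI; have [I0 Ile IU] := idI; split=> [[_ sI] x Ix|h].
  pose D := [set u : L | exists y z,
    [/\ I y, (x `&` z = \bot)%O & (u <= y `|` z)%O]].
  have : ideal_sup [set J | J = I \/ J = Ann x] `<=` D.
    apply: ideal_sup_sub; first split.
    - by exists \bot%O, \bot%O; rewrite meetx0 le0x.
    - move=> u v uv [y [z [Iy xz vyz]]]; exists y, z; split=> //.
      exact: le_trans vyz.
    - move=> u v [y [z [Iy xz uyz]]] [y' [z' [Iy' xz' vyz']]].
      exists (y `|` y')%O, (z `|` z')%O; split; first exact: IU.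
        by rewrite meetUr xz xz' joinxx.
      by rewrite joinACA leU2.
    - move=> _ [->|->] u; [move=> Iu|move=> xu].
        by exists u, \bot%O; rewrite meetx0 joinx0.
      by exists \bot%O, u; rewrite join0x.
  rewrite sI // => /(_ \top%O Logic.I)[y [z [Iy xz yz]]].
  by exists y, z; split=> //; apply/eqP; rewrite -le1x.
split=> // x Ix; have [y [z [Iy xz yz]]] := h x Ix.
apply: ideal_topP; first exact: ideal_sup_ideal.
have [_ _ U] := ideal_sup_ideal [set J | J = I \/ J = Ann x].
rewrite -yz; apply: U.
  by apply: (ideal_sup_ub (I := I)) => //; left.
by apply: (ideal_sup_ub (I := Ann x)) => //; right.
Qed.

Lemma sigma_idealT : sigma_ideal (@setT L).
Proof.
apply/sigma_idealP => // x _; exists \top%O, \bot%O.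
by rewrite meetx0 joinx0.
Qed.

Lemma sigma_idealI I J :
  sigma_ideal I -> sigma_ideal J -> sigma_ideal (I `&` J).
Proof.
move=> [idI sI] [idJ sJ].
have [[I0 Ile IU] [J0 Jle JU]] := (idI, idJ).
apply/sigma_idealP.
  split=> // [x y xy [Iy Jy]|x y [Ix Jx] [Iy Jy]].
    by split; [apply: Ile Iy|apply: Jle Jy].
  by split; [apply: IU|apply: JU].
move=> x [Ix Jx].
have [y [z [Iy xz yz]]] := (iffLR (sigma_idealP idI)) (conj idI sI) x Ix.
have [y' [z' [Jy xz' yz']]] :=
  (iffLR (sigma_idealP idJ)) (conj idJ sJ) x Jx.
exists (y `&` y')%O, (z `|` z')%O; split.
- by split; [apply: Ile Iy; exact: leIl|apply: Jle Jy; exact: leIr].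
- by rewrite meetUr xz xz' joinxx.
- apply/eqP; rewrite -le1x joinIl lexI {1}joinA yz join1x lexx /=.
  by rewrite joinCA yz' joinx1.
Qed.

(** The elements [x] with the required splitting form an ideal: for [x] and [x']
    one joins the elements of the ideal and meets the annihilators. *)
Lemma sigma_ideal_sup F :
  (forall I, F I -> sigma_ideal I) -> sigma_ideal (ideal_sup F).
Proof.
move=> sF; have idS := ideal_sup_ideal F; have [S0 Sle SU] := idS.
apply/sigma_idealP => //.
apply: (@ideal_sup_sub F [set x | exists y z,
    [/\ ideal_sup F y, (x `&` z = \bot)%O & (y `|` z = \top)%O]]).
  split.
  - by exists \bot%O, \top%O; rewrite meetx1 join0x.
  - move=> x x' xx' [y [z [Sy xz yz]]]; exists y, z; split=> //.
    by apply/eqP; rewrite -lex0 -xz leI2.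
  - move=> x x' [y [z [Sy xz yz]]] [y' [z' [Sy' xz' yz']]].
    exists (y `|` y')%O, (z `&` z')%O; split; first exact: SU.
      by rewrite meetUl meetA xz meet0x meetCA xz' meetx0 joinxx.
    apply/eqP; rewrite -le1x joinIr lexI joinAC yz join1x lexx /=.
    by rewrite -joinA yz' joinx1.
move=> I FI x Ix; have sI := sF I FI; have [idI _] := sI.
have [y [z [Iy xz yz]]] := (iffLR (sigma_idealP idI)) sI x Ix.
by exists y, z; split=> //; exact: ideal_sup_ub Iy.
Qed.

(** The elements [j] such that [x] meets [j] inside the right-hand side, for
    every [x] of [I], form an ideal. *)
Lemma ideal_meet_sup I F : is_ideal I -> (forall J, F J -> is_ideal J) ->
  I `&` ideal_sup F `<=` ideal_sup [set I `&` J | J in F].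
Proof.
move=> [I0 Ile IU] idF; set K := ideal_sup [set _ | _ in _].
have [K0 Kle KU] : is_ideal K by exact: ideal_sup_ideal.
suff h : ideal_sup F `<=` [set j | forall x, I x -> K (x `&` j)%O].
  by move=> x [Ix /h/(_ x Ix)]; rewrite meetxx.
apply: ideal_sup_sub.
  split=> [x Ix|j j' jj' h x Ix|j j' h h' x Ix].
  - by rewrite meetx0.
  - by apply: Kle (h x Ix); rewrite leI2.
  - by rewrite meetUr; apply: KU; [exact: h|exact: h'].
move=> J FJ j Jj x Ix; have [_ Jle _] := idF J FJ.
apply: (@ideal_sup_ub _ (I `&` J)); first by exists J.
by split; [apply: Ile Ix; exact: leIl|apply: Jle Jj; exact: leIr].
Qed.

End SigmaIdeals.

Lemma VId_frame_exists {disp : Order.disp_t} (L : tbDistrLatticeType disp) :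
  exists F : frame (VId L), VId_frame F.
Proof.
have eqI : injective (@vid_set disp L).
  move=> [I sI] [J sJ] /= e; case: J / e sJ => sJ.
  by congr MkVId; exact: Prop_irrelevance.
pose meet (I J : VId L) := MkVId (sigma_idealI (vidP I) (vidP J)).
have sS (S : set (VId L)) J : [set (I : set L) | I in S] J -> sigma_ideal J.
  by case=> I _ <-; exact: vidP.
pose sup S := MkVId (sigma_ideal_sup (sS S)).
have [||||F [FT FM FS]] := @frame_of_sets _ _ (@vid_set disp L)
    (MkVId (@sigma_idealT disp L)) meet sup eqI.
- by [].
- by [].
- move=> S y; split=> [Sy x Sx|h].
    by apply: subset_trans Sy; apply: ideal_sup_ub; exists x.
  apply: ideal_sup_sub; first by case: (vidP y).
  by move=> _ [x Sx <-]; exact: h.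
- move=> x S; apply: subset_trans; first apply: ideal_meet_sup.
  + by case: (vidP x).
  + by move=> J /sS[].
  apply: ideal_sup_sub; first exact: ideal_sup_ideal.
  move=> _ [_ [y Sy <-] <-]; apply: (ideal_sup_ub (I := vid_set (meet x y))).
  by exists (meet x y) => //; exists y.
by exists F; split; rewrite ?FT ?FM ?FS.
Qed.

(** * Pure congruences and the reticulation *)

Section Pure.
Variables (s : signature) (V : variety s).
Hypotheses (modV : congruence_modular V) (sdV : semidegenerate V).
Variable A : algebra s.
Hypothesis VA : V A.
Implicit Types a b c d t u : con A.

Lemma pure_Nabla : pure_con V (Nabla A).
Proof. by move=> a _ _; apply: con_eqT; exact: con_joinl. Qed.

(** Both [t] and [u] are coprime to [perp V a], hence so is their commutator,
    which is below the intersection. *)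
Lemma pure_meet t u :
  pure_con V t -> pure_con V u -> pure_con V (con_meet t u).
Proof.
move=> tP uP a ca atu.
have ta : con_join (perp V a) t = Nabla A.
  by rewrite con_joinC tP // => p /atu[].
have ua : con_join (perp V a) u = Nabla A.
  by rewrite con_joinC uP // => p /atu[].
rewrite con_joinC; apply: con_join_eqT (comm_coprime modV sdV VA ta ua) => //.
by move=> p ctu; split; [exact: comm_subl ctu|exact: comm_subr ctu].
Qed.

(** The congruences whose annihilator is coprime to the join are closed under
    finite joins and contain the compact parts of the members of [S]. *)
Lemma pure_sup (S : set (con A)) :
  (forall t, S t -> pure_con V t) -> pure_con V (con_sup S).
Proof.
move=> SP a ca aS.
pose P := [set b | con_join (con_sup S) (perp V b) = Nabla A].
have P0 : P !=set0.
  exists (Delta A); apply: con_eqT; apply: subset_trans (@con_joinr _ _ _ _).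
  apply/(perpP modV VA)/con_eq; last exact: Delta_sub.
  exact: comm_subl.
have dirP b c : P b -> P c -> exists2 d, P d & b `<=` d /\ c `<=` d.
  move=> Pb Pc; exists (con_join b c); first exact: perp_join_coprime.
  by split; [exact: con_joinl|exact: con_joinr].
have SsubP : con_sup S `<=` con_sup P.
  apply/con_supP => t St; apply: compact_le => c cc ct.
  apply: con_sup_ub; apply: con_join_eqT (SP t St c cc ct) => //.
  exact: con_sup_ub.
have [b Pb ab] := compact_le_sup P0 dirP ca (subset_trans aS SsubP).
by apply: con_join_eqT Pb => //; exact: perp_anti.
Qed.

(** A compact [a] below a pure [t] satisfies [a = comm a t], so that the
    distributivity of the commutator can be used in place of that of the
    intersection, which fails in general. *)
Lemma pure_meet_sup t (S : set (con A)) : pure_con V t ->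
  con_meet t (con_sup S) `<=` con_sup [set con_meet t u | u in S].
Proof.
move=> tP; apply: compact_le => a ca atS.
have at_ : a `<=` t by move=> p /atS[].
have aS : a `<=` con_sup S by move=> p /atS[].
have E : a `<=` comm V a t.
  rewrite -{1}(comm_Nabla modV sdV VA a) -(tP a ca at_) commC //.
  apply: comm_joinl => //; first by rewrite commC.
  by rewrite commC // comm_perp //; exact: Delta_sub.
apply: (subset_trans E).
apply: (subset_trans (comm_mono modV VA aS (@subset_refl _ t))).
apply: comm_supl => // u Su p cut.
apply: (@con_sup_ub _ _ _ (con_meet t u)); first by exists u.
by split; [exact: comm_subr cut|exact: comm_subl cut].
Qed.

Lemma VCon_frame_exists : exists F : frame (VCon V A), VCon_frame F.
Proof.
have eqI : injective (fun t : VCon V A => con_rel t).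
  move=> [t tP] [u uP] /= e.
  have {}e : t = u by apply: con_eq; rewrite e.
  by case: u / e uP => uP; congr MkVCon; exact: Prop_irrelevance.
pose meet (t u : VCon V A) :=
  MkVCon (pure_meet (@vconP _ _ _ t) (@vconP _ _ _ u)).
have SP (S : set (VCon V A)) t : [set (t : con A) | t in S] t -> pure_con V t.
  by case=> u _ <-; exact: (@vconP _ _ _ u).
pose sup S := MkVCon (pure_sup (SP S)).
have [||||F [FT FM FS]] := @frame_of_sets _ _ (fun t : VCon V A => con_rel t)
    (MkVCon pure_Nabla) meet sup eqI.
- by [].
- by [].
- move=> S y; split=> [/con_supP Sy x Sx|h].
    by apply: Sy; exists x.
  by apply/con_supP => _ [x Sx <-]; exact: h.
- move=> x S; apply: subset_trans.
    exact: (pure_meet_sup (@vconP _ _ _ x)).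
  apply/con_supP => _ [_ [y Sy <-] <-].
  apply: (@con_sup_ub _ _ _ (vcon_con (meet x y))).
  by exists (meet x y) => //; exists y.
by exists F; split; rewrite ?FT ?FM ?FS.
Qed.

End Pure.

Section Star.
Variables (s : signature) (V : variety s).
Hypotheses (modV : congruence_modular V) (sdV : semidegenerate V).
Variable A : algebra s.
Hypotheses (VA : V A) (KA : compact_closed V A).
Implicit Types (a b c d t u : con A).

Local Notation L := (reticulation sdV VA KA).
Local Notation lam := (lambda sdV VA KA).
Implicit Types (I J : set L) (x y z : L).

Lemma lambda_meetE (a b : kcon A) : (lam a `&` lam b)%O = lam (kcomm KA a b).
Proof. exact: lambda_meet. Qed.

Lemma lambda_joinE (a b : kcon A) : (lam a `|` lam b)%O = lam (kjoin a b).
Proof. exact: lambda_join. Qed.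

Lemma lambda_le (a b : kcon A) : a `<=` b -> (lam a <= lam b)%O.
Proof.
move=> ab; rewrite leEmeet lambda_meetE; apply/eqP/lambdaP => phi phiP.
rewrite (comm_primeP _ _ VA phiP); split=> [[//|h]|]; last by left.
exact: subset_trans h.
Qed.

(** All powers of [Nabla] are [Nabla], so a congruence contained in no prime is
    [Nabla] itself. *)
Lemma lambda_joinT (a b : kcon A) :
  (lam a `|` lam b)%O = \top%O <-> con_join a b = Nabla A.
Proof.
rewrite lambda_joinE; split=> [/lambda_eq e|e].
  have cN := compact_Nabla sdV VA.
  have [|n] := rho_nilpotent modV VA KA (t := con_join a b) cN.
    by rewrite [X in _ `<=` con_rel X]e => p Np phi [_]; apply.
  by rewrite comm_iter_Nabla // => /con_eqT.
by apply/lambdaP => phi phiP; rewrite kjoinE e.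
Qed.

Lemma lambda_meet0 (a b : kcon A) : comm V a b = Delta A ->
  (lam a `&` lam b)%O = \bot%O.
Proof.
by move=> e; rewrite lambda_meetE; apply/lambdaP => phi _; rewrite kcommE e.
Qed.

Lemma lambda_meet0_nilpotent (a b : kcon A) : (lam a `&` lam b)%O = \bot%O ->
  exists n, comm_iter V a b n.+1 = Delta A.
Proof.
rewrite lambda_meetE => /lambda_eq e.
have [|n cn] := rho_nilpotent modV VA KA (t := Delta A) (kconP (kcomm KA a b)).
  move=> p pab; rewrite -[X in con_rel X]e => phi [_]; exact.
by exists n; rewrite comm_iter_comm; apply: con_eq cn _; exact: Delta_sub.
Qed.

Lemma lambda_iter (a : kcon A) n :
  lam (KCon (comm_iter_compact KA (n := n) (kconP a))) = lam a.
Proof. by apply/lambdaP => phi phiP /=; exact: comm_iter_prime. Qed.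

Lemma star_ideal t : is_ideal (star sdV VA KA t).
Proof.
split.
- by exists (KCon (@compact_Delta _ A)) => //; exact: Delta_sub.
- elim/ret_ind=> a y ay [b bt by_]; rewrite -by_ in ay.
  exists (kcomm KA a b).
    by apply: subset_trans bt; exact: comm_subr.
  by rewrite -lambda_meetE; exact/eqP.
- move=> _ _ [a at_ <-] [b bt <-]; exists (kjoin a b); first exact/con_joinP.
  by rewrite -lambda_joinE.
Qed.

Lemma star_sigma t : pure_con V t -> sigma_ideal (star sdV VA KA t).
Proof.
move=> tP; apply/sigma_idealP; first exact: star_ideal.
move=> _ [a at_ <-].
have [b [c [cb cc bt ca bc]]] :=
  Nabla_join_compact (compact_Nabla sdV VA) (tP a (kconP a) at_).
exists (lam (KCon cb)), (lam (KCon cc)); split.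
- by exists (KCon cb).
- by apply: lambda_meet0; exact/(perpP modV VA).
- exact/lambda_joinT.
Qed.

(** If [a] below [t] and [b] below [u] have the same class, this is also the
    class of [comm V a b]. *)
Lemma star_meet t u :
  star sdV VA KA (con_meet t u) = star sdV VA KA t `&` star sdV VA KA u.
Proof.
apply/seteqP; split=> [_ [a atu <-]|_ [[a at_ <-] [b bu ba]]].
  by split; exists a => // p /atu[].
exists (kcomm KA a b); last by rewrite -lambda_meetE ba meetxx.
move=> p cab; split; first exact/at_/(comm_subl VA cab).
exact/bu/(comm_subr VA cab).
Qed.

Lemma star_Nabla : star sdV VA KA (Nabla A) = setT.
Proof. by apply/seteqP; split=> //; elim/ret_ind => a _; exists a. Qed.

Lemma ideal_compact_sup I (a : kcon A) : is_ideal I ->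
  a `<=` con_sup [set (b : con A) | b in [set b : kcon A | I (lam b)]] ->
  I (lam a).
Proof.
move=> [I0 Ile IU] aI.
have [|_ _ [b Ib <-] [c Ic <-]|_ [b Ib <-] ab] :=
  compact_le_sup _ _ (kconP a) aI.
- by exists (Delta A), (KCon (@compact_Delta _ A)).
- exists (kjoin b c).
    by exists (kjoin b c) => //=; rewrite -lambda_joinE; exact: IU.
  by split; [exact: con_joinl|exact: con_joinr].
- by apply: Ile Ib; exact: lambda_le.
Qed.

Lemma star_sup (S : set (con A)) : star sdV VA KA (con_sup S) =
  ideal_sup [set star sdV VA KA t | t in S].
Proof.
apply/seteqP; split; last first.
  apply: ideal_sup_sub; first exact: star_ideal.
  move=> _ [t St <-] _ [a at_ <-]; exists a => //.
  by apply: (subset_trans at_); exact: con_sup_ub.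
move=> _ [a aS <-]; apply: ideal_compact_sup; first exact: ideal_sup_ideal.
apply: (subset_trans aS); apply/con_supP => t St.
apply: compact_le => c cc ct; apply: con_sup_ub; exists (KCon cc) => //=.
apply: (@ideal_sup_ub _ _ _ (star sdV VA KA t)); first by exists t.
by exists (KCon cc).
Qed.

Definition pure_core I : con A :=
  con_sup [set a | exists2 b : kcon A,
    I (lam b) & con_join b (perp V a) = Nabla A].

Lemma compact_le_pure_core I a : is_ideal I -> compact_con a ->
  a `<=` pure_core I ->
  exists2 b : kcon A, I (lam b) & con_join b (perp V a) = Nabla A.
Proof.
move=> [I0 Ile IU] ca /(compact_le_sup _ _ ca)[||b [c Ic cb] ab].
- exists (Delta A), (KCon (@compact_Delta _ A)) => //.
  apply: con_eqT; apply: subset_trans (@con_joinr _ _ _ _).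
  apply/(perpP modV VA)/con_eq; last exact: Delta_sub.
  exact: comm_subl.
- move=> b c [b' Ib bb'] [c' Ic cc']; exists (con_join b c).
    exists (kjoin b' c'); first by rewrite -lambda_joinE; exact: IU.
    apply: perp_join_coprime => //.
      by apply: con_join_eqT bb' => //; exact: con_joinl.
    by apply: con_join_eqT cc' => //; exact: con_joinr.
  by split; [exact: con_joinl|exact: con_joinr].
- by exists c => //; apply: con_join_eqT cb => //; exact: perp_anti.
Qed.

(** If [b] has the class of some [c] below [t] and [b \/ perp a = Nabla], then
    [c \/ perp a = Nabla] since coprimality depends on classes only; therefore
    [a] is below [c]. *)
Lemma pure_core_star t : pure_con V t -> pure_core (star sdV VA KA t) = t.
Proof.
move=> tP; apply: con_eq.
  apply/con_supP => a [b [c ct cb] ba].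
  apply: (perp_coprime_sub modV sdV VA).
  have [d [e [cd ce db ea de]]] :=
    Nabla_join_compact (compact_Nabla sdV VA) ba.
  have /(lambda_joinT _ (KCon ce)) bT : con_join b (KCon ce) = Nabla A.
    by apply: con_join_eqT de.
  rewrite -cb in bT; move/lambda_joinT: bT; exact: con_join_eqT.
apply: compact_le => a ca at_; apply: con_sup_ub.
have [b [c [cb cc bt cp bc]]] :=
  Nabla_join_compact (compact_Nabla sdV VA) (tP a ca at_).
exists (KCon cb); first by exists (KCon cb).
by apply: con_join_eqT bc.
Qed.

Hypothesis starA : cond_star V A.

(** Here [cond_star] trades the nilpotency of [comm V a c] for the orthogonality
    of powers of [a] and [c]. *)
Lemma comm_iter_le_pure_core I (a : kcon A) : sigma_ideal I -> I (lam a) ->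
  exists n, comm_iter V a a n `<=` pure_core I.
Proof.
move=> sI Ia; have [idI _] := sI.
have [y [z [Iy ay yz]]] := (iffLR (sigma_idealP idI)) sI _ Ia.
elim/ret_ind: y Iy yz => b Ib; elim/ret_ind: z ay => c ac bc.
have [n acn] := lambda_meet0_nilpotent ac.
have [m le] := starA (kconP a) (kconP c) (ltn0Sn n).
exists m; apply: con_sup_ub; exists b => //.
move/lambda_joinT/(comm_iter_coprime modV sdV VA m): bc.
apply: con_join_eqT => //; apply/(perpP modV VA)/con_eq; last exact: Delta_sub.
by rewrite -acn.
Qed.

Lemma pure_core_pure I : sigma_ideal I -> pure_con V (pure_core I).
Proof.
move=> sI a ca /(compact_le_pure_core (proj1 sI) ca)[b Ib ba].
have [n bn] := comm_iter_le_pure_core sI Ib.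
rewrite con_joinC in ba; rewrite con_joinC.
by apply: con_join_eqT (comm_iter_coprime modV sdV VA n ba).
Qed.

Lemma star_pure_core I : sigma_ideal I -> star sdV VA KA (pure_core I) = I.
Proof.
move=> sI; have [idI _] := sI; apply/seteqP; split.
  move=> _ [a aI <-].
  have [b Ib /(perp_coprime_sub modV sdV VA) ab] :=
    compact_le_pure_core idI (kconP a) aI.
  by case: idI => _ Ile _; apply: Ile Ib; exact: lambda_le.
elim/ret_ind => a Ia; have [n an] := comm_iter_le_pure_core sI Ia.
by rewrite -(lambda_iter a n); eexists; last reflexivity.
Qed.

End Star.

Theorem theorem4p17 (s : signature) (V : variety s)
    (modV : congruence_modular V) (sdV : semidegenerate V)
    (A : algebra s) (VA : V A) (KA : compact_closed V A)
    (starA : cond_star V A) :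
  exists (FV : frame (VCon V A))
         (FI : frame (VId (reticulation sdV VA KA)))
         (w : VCon V A -> VId (reticulation sdV VA KA)),
    [/\ VCon_frame FV,
        VId_frame FI,
        forall t : VCon V A, vid_set (w t) = star sdV VA KA t &
        frame_iso FV FI w].
Proof.
have [FV FVP] := VCon_frame_exists modV sdV VA.
have [FI FIP] := VId_frame_exists (reticulation sdV VA KA).
pose w (t : VCon V A) := MkVId (star_sigma modV sdV VA KA (@vconP _ _ _ t)).
exists FV, FI, w; split=> //.
have [FVT FVM FVS] := FVP; have [FIT FIM FIS] := FIP.
have eqI (I J : VId (reticulation sdV VA KA)) :
    vid_set I = vid_set J -> I = J.
  case: I J => [I sI] [J sJ] /= e; case: J / e sJ => sJ.
  by congr MkVId; exact: Prop_irrelevance.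
split.
- exists (fun I => MkVCon (pure_core_pure modV starA (vidP I))).
    move=> t; case: t => t tP.
    have e := pure_core_star modV sdV VA KA tP.
    move: (pure_core_pure _ _ _); rewrite /= e => tP'.
    by congr MkVCon; exact: Prop_irrelevance.
  move=> I; apply: eqI => /=. exact: (star_pure_core modV starA (vidP I)).
- by apply: eqI; rewrite /= FVT star_Nabla FIT.
- by move=> t u; apply: eqI; rewrite /= FVM star_meet // FIM.
- move=> S; apply: eqI; rewrite /= FVS star_sup // FIS; congr ideal_sup.
  by rewrite !image_comp.
Qed.
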